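(* For each $n$ let $Z_n=\coprod_i Z_n^i$ be a finite disjoint union of compact, connected, Hausdorff spaces, let $r_n$ be a natural number, let $p_n^i\in C(Z_n^i)\otimes M_{r_n}$ be projections, and let $A_n=\bigoplus_i p_n^i(C(Z_n^i)\otimes M_{r_n})p_n^i$. Let $p_n=(p_n^i)_i\in C(Z_n)\otimes M_{r_n}$. Suppose that for every $n$ the projection $p_n$ is, over each connected component of $Z_n$, a sum of line bundles. For each $n$ let $\varphi_n:A_n\to A_{n+1}$ be a unital, injective, generalized diagonal homomorphism, i.e. $$\varphi_n(a)=\sum_{y\in\mathcal{Y}(n)}(a\circ\lambda_y)\otimes q_y ,$$ where $\mathcal{Y}(n)$ is a finite index set, $\lambda_y:Z_{n+1}\to Z_n$ ($y\in\mathcal{Y}(n)$) are continuous maps, and $q_y\in C(Z_{n+1})\otimes M_{s_n}$ ($y\in\mathcal{Y}(n)$) are pairwise orthogonal projections, with $r_ns_n=r_{n+1}$. Suppose further that for every $y\in\mathcal{Y}(n)$ there is an index $j(y)$ such that $q_y|_{Z_{n+1}^{j(y)}}$ is a line bundle and $q_y|_{Z_{n+1}^j}=0$ for all $j\neq j(y)$. Then the inductive limit C*-algebra $A=\varinjlim_n\{A_n,\varphi_n\}$ has a C*-diagonal.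
   Context: Elements of $A_n$ are viewed as $M_{r_n}$-valued continuous functions on $Z_n$. $(a\circ\lambda_y)\otimes q_y$ denotes the function sending $z\in Z_{n+1}$ to $a(\lambda_y(z))\otimes q_y(z)\in M_{r_n}\otimes M_{s_n}\cong M_{r_{n+1}}$, where a fixed isomorphism $M_{r_n}\otimes M_{s_n}\cong M_{r_{n+1}}$ is used. Projections in $C(Z)\otimes M_r$ are identified with the corresponding complex vector bundles over $Z$: ''line bundle'' means rank-one projection, and ''sum of line bundles'' means that the corresponding vector bundle is a direct sum of line bundles (equivalently, the projection is a sum of pairwise orthogonal rank-one projections). Unitality of $\varphi_n$ means $\varphi_n(p_n)=p_{n+1}$, i.e. $p_{n+1}=\sum_{y\in\mathcal{Y}(n)}(p_n\circ\lambda_y)\otimes q_y$. A sub-C*-algebra $B$ of a unital C*-algebra $A$ is a Cartan subalgebra if: $B$ is maximal abelian in $A$; $B$ is regular, i.e. the set of normalizers $N_A(B)=\{n\in A: nBn^*\subseteq B \text{ and } n^*Bn\subseteq B\}$ generates $A$ as a C*-algebra; and there is a faithful conditional expectation $P:A\to B$ onto $B$. A Cartan subalgebra $B$ of $A$ is a C*-diagonal if moreover every pure state of $B$ extends uniquely to a (necessarily pure) state of $A$. *)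

(* Defs.v *)
From HB Require Import structures.
From mathcomp Require Import all_boot all_order all_algebra.
From mathcomp Require Import all_classical all_reals all_analysis.
From mathcomp Require Import complex.
From mathcomp Require mxtens.

Set Implicit Arguments.
Unset Strict Implicit.
Unset Printing Implicit Defensive.

Import Order.TTheory GRing.Theory Num.Theory.
Import numFieldNormedType.Exports.

Local Open Scope classical_set_scope.
Local Open Scope ring_scope.
Local Open Scope complex_scope.
Local Open Scope sesquilinear_scope.

(* MathComp-Analysis equips abstract numFieldTypes with the topology of their
   norm; the concrete field R[i] has to be given it explicitly. *)
HB.instance Definition _ (R : realType) := NormedModule.copy R[i] (R[i])^o.

(* The multiplication is part of the mixin: the hierarchy of structures has no
   join of PzRing and NormedModule, and algebras over R[i] that are nzRings would
   exclude the zero C*-algebra. *)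
HB.mixin Record isCStarAlgebra (R : realType) A of CompleteNormedModule R[i] A := {
  cmul : A -> A -> A ;
  cone : A ;
  star : A -> A ;
  cmulA : associative cmul ;
  cmul1l : left_id cone cmul ;
  cmul1r : right_id cone cmul ;
  cmulDl : left_distributive cmul +%R ;
  cmulDr : right_distributive cmul +%R ;
  cmulZl : forall (c : R[i]) x y, cmul (c *: x) y = c *: cmul x y ;
  cmulZr : forall (c : R[i]) x y, cmul x (c *: y) = c *: cmul x y ;
  cmul_norm : forall x y, `|cmul x y| <= `|x| * `|y| ;
  starK : involutive star ;
  starD : {morph star : x y / x + y} ;
  starZ : forall (c : R[i]) x, star (c *: x) = c^* *: star x ;
  starM : forall x y, star (cmul x y) = cmul (star y) (star x) ;
  cstar_norm : forall x, `|cmul (star x) x| = `|x| ^+ 2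
}.

#[short(type="cstarAlgebraType")]
HB.structure Definition CStarAlgebra (R : realType) :=
  {A of CompleteNormedModule R[i] A & isCStarAlgebra R A}.

Declare Scope cstar_scope.
Delimit Scope cstar_scope with CS.
Local Open Scope cstar_scope.
Infix "**" := cmul (at level 40, left associativity) : cstar_scope.

Section CStarDiagonal.
Context {R : realType} {A : cstarAlgebraType R}.

Definition sub_cstar_algebra (B : set A) : Prop :=
  [/\ closed B,
      B 0,
      forall x y, B x -> B y -> B (x + y) /\ B (x ** y),
      forall (c : R[i]) x, B x -> B (c *: x)
    & forall x, B x -> B (star x)].

Definition abelian_set (B : set A) : Prop :=
  forall x y, B x -> B y -> x ** y = y ** x.

Definition maximal_abelian (B : set A) : Prop :=
  abelian_set B /\
  forall B' : set A, sub_cstar_algebra B' -> abelian_set B' ->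
    B `<=` B' -> B' `<=` B.

Definition normalizers (B : set A) : set A :=
  [set n | forall b, B b -> B (n ** b ** star n) /\ B (star n ** b ** n)].

Definition generates (X : set A) : Prop :=
  forall S : set A, sub_cstar_algebra S -> X `<=` S -> S = setT.

Definition positive (x : A) : Prop := exists y, x = star y ** y.

Definition conditional_expectation (B : set A) (P : A -> A) : Prop :=
  [/\ forall (c : R[i]) x y, P (c *: x + y) = c *: P x + P y,
      (forall x, B (P x)) /\ (forall b, B b -> P b = b),
      forall x, `|P x| <= `|x|,
      forall x, positive x -> positive (P x)
    & forall b c x, B b -> B c -> P (b ** x ** c) = b ** P x ** c].

Definition faithful (P : A -> A) : Prop :=
  forall x, P (star x ** x) = 0 -> x = 0.

Definition cartan_subalgebra (B : set A) : Prop :=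
  [/\ sub_cstar_algebra B,
      maximal_abelian B,
      generates (normalizers B)
    & exists P : A -> A, conditional_expectation B P /\ faithful P].

(* States of a sub-C*-algebra S containing the unit of A, as functions on A of
   which only the values on S matter. A positive functional on S has norm one
   exactly when it is unital. *)
Definition state_on (S : set A) (f : A -> R[i]) : Prop :=
  [/\ forall (c : R[i]) x y, S x -> S y -> f (c *: x + y) = c * f x + f y,
      forall x, S x -> 0 <= f (star x ** x)
    & f (@cone R A) = 1].

Definition pure_state_on (S : set A) (f : A -> R[i]) : Prop :=
  state_on S f /\
  forall (g h : A -> R[i]) (t : R), state_on S g -> state_on S h ->
    0 < t < 1 ->
    (forall x, S x -> f x = t%:C * g x + (1 - t)%:C * h x) ->
    forall x, S x -> g x = f x /\ h x = f x.

Definition unique_pure_state_extension (B : set A) : Prop :=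
  forall f, pure_state_on B f ->
    exists! g : A -> R[i], state_on setT g /\ (forall b, B b -> g b = f b).

Definition cstar_diagonal (B : set A) : Prop :=
  cartan_subalgebra B /\ unique_pure_state_extension B.

End CStarDiagonal.

Definition restr k (Z : 'I_k -> topologicalType) (X : Type)
  (f : {i & Z i} -> X) (i : 'I_k) : Z i -> X := fun z => f (existT _ i z).
Arguments restr {k Z X} f i z /.

Section MatrixFunctions.
Context {R : realType}.

Definition norm2 n (v : 'cV[R[i]]_n) : R :=
  Num.sqrt (\sum_i (complex.Re `|v i 0|) ^+ 2).

(* The C*-norm of M_n, as opposed to MathComp's entrywise maximum norm. *)
Definition op_norm n (M : 'M[R[i]]_n) : R :=
  sup [set norm2 (M *m v) | v in [set v | norm2 v <= 1]].

Definition sup_norm (T : Type) n (a : T -> 'M[R[i]]_n) : R :=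
  sup [set op_norm (a z) | z in setT].

Section Bundles.
Context {T : topologicalType} {n : nat}.
Implicit Types p e a : T -> 'M[R[i]]_n.

Definition projection p : Prop :=
  continuous p /\ forall z, p z *m p z = p z /\ (p z)^t* = p z.

Definition orthogonal_fun p e : Prop := forall z, p z *m e z = 0.

Definition line_bundle p : Prop :=
  projection p /\ forall z, \rank (p z) = 1%N.

Definition sum_of_line_bundles p : Prop :=
  exists (m : nat) (e : 'I_m -> T -> 'M[R[i]]_n),
    [/\ forall l, line_bundle (e l),
        forall l l', l != l' -> orthogonal_fun (e l) (e l')
      & forall z, p z = \sum_l e l z].

(* The C*-algebra p (C(T) (x) M_n) p, with pointwise operations and sup_norm. *)
Definition corner p : set (T -> 'M[R[i]]_n) :=
  [set (fun z => p z *m b z *m p z) | b in [set b : T -> 'M[R[i]]_n | continuous b]].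

Definition star_hom (A : cstarAlgebraType R) (S : set (T -> 'M[R[i]]_n))
    (f : (T -> 'M[R[i]]_n) -> A) : Prop :=
  [/\ forall a b, S a -> S b -> f (fun z => a z + b z) = f a + f b,
      forall (c : R[i]) a, S a -> f (fun z => c *: a z) = c *: f a,
      forall a b, S a -> S b -> f (fun z => a z *m b z) = f a ** f b
    & forall a, S a -> f (fun z => (a z)^t*) = star (f a)].

End Bundles.

Definition matrix_star_iso m n (theta : 'M[R[i]]_m -> 'M[R[i]]_n) : Prop :=
  [/\ forall (c : R[i]) M N, theta (c *: M + N) = c *: theta M + theta N,
      forall M N, theta (M *m N) = theta M *m theta N,
      forall M, theta (M ^t*) = (theta M)^t*
    & bijective theta].

(* a |-> \sum_y (a o lam_y) (x) q_y, where theta identifies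
   M_r (x) M_s = M_(r * s) (Kronecker product) with M_r' *)
Definition diagonal_map (T T' : Type) (r s r' : nat) (Y : finType)
    (theta : 'M[R[i]]_(r * s) -> 'M[R[i]]_r')
    (lam : Y -> T' -> T) (q : Y -> T' -> 'M[R[i]]_s)
    (a : T -> 'M[R[i]]_r) : T' -> 'M[R[i]]_r' :=
  fun z => \sum_y theta (mxtens.tensmx (a (lam y z)) (q y z)).

End MatrixFunctions.

Fixpoint iterate_maps (X : nat -> Type) (phi : forall n, X n -> X n.+1)
    (n : nat) (a : X n) (m : nat) : X (m + n)%N :=
  if m is m'.+1 then phi (m' + n)%N (iterate_maps phi a m') else a.

(* (A, mu) is the inductive limit of the C*-algebras p_n (C(T_n) (x) M_(r_n)) p_n
   along phi: the algebraic direct limit carries the C*-seminorm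
     |[a]| = lim_m |phi_(n+m-1) (... (phi_n a))|   for a in the n-th algebra,
   and A is the completion of its Hausdorff quotient, with canonical maps mu_n. *)
Definition inductive_limit (R : realType) (T : nat -> topologicalType)
    (r : nat -> nat) (p : forall n, T n -> 'M[R[i]]_(r n))
    (phi : forall n, (T n -> 'M[R[i]]_(r n)) -> (T n.+1 -> 'M[R[i]]_(r n.+1)))
    (A : cstarAlgebraType R)
    (mu : forall n, (T n -> 'M[R[i]]_(r n)) -> A) : Prop :=
  [/\ forall n, star_hom (corner (p n)) (mu n),
      forall n a, corner (p n) a -> mu n.+1 (phi n a) = mu n a,
      forall n a, corner (p n) a ->
        (fun m => sup_norm (iterate_maps phi a m)) @ \oo --> complex.Re `|mu n a|
    & dense (\bigcup_n (mu n @` corner (p n)))].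

(* Main.v *)
Require Import Defs.
From HB Require Import structures.
From mathcomp Require Import all_boot all_order all_algebra.
From mathcomp Require Import all_classical all_reals all_analysis.
From mathcomp Require Import complex mxtens ring lra.

Set Implicit Arguments.
Unset Strict Implicit.
Unset Printing Implicit Defensive.

Import Order.TTheory GRing.Theory Num.Theory.
Import numFieldNormedType.Exports.

Local Open Scope classical_set_scope.
Local Open Scope ring_scope.
Local Open Scope sesquilinear_scope.

(** A unital diagonal map carries a decomposition of [p n] into rank-one projections
    to one of [p n.+1]: an [E] of level [n] gives the [theta (E o lam_y (x) q_y)], each
    of rank at most one because [q_y] is.  Starting from the line bundles of level 0,
    the compressions to the resulting families are compatible with the connecting maps
    and extend to a contractive expectation [P] of the limit onto the commutant [D] of
    all these projections.  That [D] is maximal abelian is then immediate.  Blocks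
    [E a F] stay monomial in all later families, so they normalize [D], and they span.
    For faithfulness, [P (x^* x) = 0] forces [P ((x u)^* (x u)) = 0] for every [u] of a
    finite level, while the norm of an element [a] of a finite level is a supremum of
    [|P ((a u)^* (a u))|^(1/2)] over contractions [u].  A pure state of [D] takes the
    value 1 on exactly one projection of each family, so by Cauchy-Schwarz an extension
    factors through compression by that projection, that is, through [P]. *)

(** Faithfulness is the main obstacle. On one level it is clear, but the constant in a bound of the
    norm of [a] by that of [P (a^* a)] degrades with the number of lines, so it does not survive
    completion. A contraction [u] carrying the unit vector of a line to a vector on which [a] is
    large removes the constant, and [P (w^* x w) = w^* P x w] for monomial [w] transports the
    vanishing of [P (x^* x)] to [x u]. Positivity is the second one: [positive] asks for a
    factorization, so [P (x^* x)] needs a genuine square root. On a level it is taken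
    coefficientwise, and |sqrt s - sqrt t|^2 <= |s - t| lets the roots converge along an
    approximation of [x]. The third is isometry: [theta] is known only algebraically. Crude linear
    bounds are made sharp by applying them to powers [2^k] and using the C*-identity. Rank at most
    one, instead of one, is what the construction preserves: a line vanishes wherever its [q_y]
    does. *)

HB.instance Definition _ (R : realType) (A : cstarAlgebraType R) :=
  GRing.Zmodule_isPzRing.Build A (@cmulA R A) (@cmul1l R A) (@cmul1r R A)
    (@cmulDl R A) (@cmulDr R A).

(** * Norm and limits in a C*-algebra *)

Section CStarNorm.
Context {R : realType} {A : cstarAlgebraType R}.
Implicit Types (x y z : A) (c : R[i]) (e : R) (S : set A).

(** The norm takes values in [R[i]]; its real part is what the arithmetic tactics over [R] can
    handle. *)
Definition nm x : R := complex.Re `|x|.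

Lemma cmulE x y : cmul x y = x * y. Proof. by []. Qed.

Lemma coneE : @cone R A = 1. Proof. by []. Qed.

Lemma nmE x : `|x| = (nm x)%:C%C.
Proof. by rewrite /nm RRe_real // normr_real. Qed.

Lemma nm_ge0 x : 0 <= nm x.
Proof. by rewrite -ler0c -nmE. Qed.

Lemma nm0 : nm 0 = 0.
Proof. by rewrite /nm normr0. Qed.

Lemma nm_eq0 x : nm x = 0 -> x = 0.
Proof. by move=> x0; apply/eqP; rewrite -normr_eq0 nmE x0. Qed.

Lemma nmD x y : nm (x + y) <= nm x + nm y.
Proof. by rewrite -lecR rmorphD /= -!nmE ler_normD. Qed.

Lemma nmN x : nm (- x) = nm x.
Proof. by rewrite /nm normrN. Qed.

Lemma nmB x y : nm (x - y) = nm (y - x).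
Proof. by rewrite -nmN opprB. Qed.

Lemma nm_subD x y z : nm (x - z) <= nm (x - y) + nm (y - z).
Proof. by rewrite (le_trans _ (nmD _ _)) // addrA subrK. Qed.

Lemma nmM x y : nm (x * y) <= nm x * nm y.
Proof. by rewrite -lecR rmorphM /= -!nmE cmul_norm. Qed.

Lemma nmZ c x : nm (c *: x) = complex.Re `|c| * nm x.
Proof. by rewrite /nm normrZ nmE normc_def -rmorphM. Qed.

Lemma nm_cstar x : nm (star x * x) = nm x ^+ 2.
Proof. by apply: complexI; rewrite -nmE cstar_norm nmE rmorphXn. Qed.

Lemma le_nm_star x : nm x <= nm (star x).
Proof.
have [->|x0] := eqVneq (nm x) 0; first exact: nm_ge0.
have xp : 0 < nm x by rewrite lt_def x0 nm_ge0.
by rewrite -(ler_pM2r xp) -expr2 -nm_cstar nmM.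
Qed.

Lemma nm_star x : nm (star x) = nm x.
Proof. by apply/eqP; rewrite eq_le le_nm_star -{2}(starK x) le_nm_star. Qed.

Lemma starMr x y : star (x * y) = star y * star x. Proof. exact: starM. Qed.

Lemma star0 : star (0 : A) = 0.
Proof. by rewrite -(scale0r (0 : A)) starZ conjC0 !scale0r. Qed.

Lemma starN x : star (- x) = - star x.
Proof. by apply/eqP; rewrite -addr_eq0 -starD addNr star0. Qed.

Lemma starB x y : star (x - y) = star x - star y.
Proof. by rewrite starD starN. Qed.

Lemma star1 : star (1 : A) = 1.
Proof.
by have := starMr (star 1) 1; rewrite mulr1 starK mulr1 => <-.
Qed.

Lemma star_sum (I : Type) (s : seq I) (P : pred I) (F : I -> A) :
  star (\sum_(i <- s | P i) F i) = \sum_(i <- s | P i) star (F i).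
Proof. by apply: (big_morph _ starD star0). Qed.

Lemma scaleMl c x y : (c *: x) * y = c *: (x * y). Proof. exact: cmulZl. Qed.

Lemma scaleMr c x y : x * (c *: y) = c *: (x * y). Proof. exact: cmulZr. Qed.

Lemma nm1 : nm 1 <= 1.
Proof.
have := nm_cstar 1; rewrite star1 mulr1 expr2 => h.
have [->|n0] := eqVneq (nm 1) 0; first exact: ler01.
by rewrite -(mulfK n0 (nm 1)) -h mulfV.
Qed.

Definition approx S x := forall e, 0 < e -> exists2 y, S y & nm (x - y) < e.

Lemma ball_nm x y e : 0 < e -> ball x (e%:C)%C y <-> nm (x - y) < e.
Proof.
by move=> e0; rewrite -ball_normE /= nmE ltcR.
Qed.

Lemma nbhs_nm x (U : set A) :
  nbhs x U <-> exists2 e, 0 < e & forall y, nm (x - y) < e -> U y.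
Proof.
split=> [/nbhs_ballP[d /= d0 dU]|[e e0 eU]].
  have dE : d = ((complex.Re d)%:C)%C by rewrite RRe_real // gtr0_real.
  have Rd0 : 0 < complex.Re d by rewrite -ltcR -dE.
  by exists (complex.Re d) => // y; rewrite -ball_nm // -dE => /dU.
apply/nbhs_ballP; exists (e%:C)%C => /=; first by rewrite ltcR.
by move=> y /ball_nm h; apply: eU; apply: h.
Qed.

Lemma closed_approx S : closed S -> forall x, approx S x -> S x.
Proof.
move=> cS x ax; apply: cS => U /nbhs_nm[e e0 eU].
by have [y Sy xy] := ax _ e0; exists y; split=> //; apply: eU.
Qed.

Lemma approx_closed S : (forall x, approx S x -> S x) -> closed S.
Proof.
move=> aS x cx; apply: aS => e e0.
have /cx[y [Sy xy]] : nbhs x [set y | nm (x - y) < e].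
  by apply/nbhs_nm; exists e.
by exists y.
Qed.

Lemma dense_approx S : dense S -> forall x, approx S x.
Proof.
move=> dS x e e0.
have : nbhs x [set y | nm (x - y) < e] by apply/nbhs_nm; exists e.
rewrite nbhsE /= => -[V [oV Vx] VS].
have [|y [Vy Sy]] := dS V _ oV; first by exists x.
by exists y => //; apply: VS.
Qed.

Definition tends (u : nat -> A) x :=
  forall e, 0 < e -> exists N, forall n, (N <= n)%N -> nm (u n - x) < e.

Lemma cauchy_tends (u : nat -> A) :
  (forall e, 0 < e -> exists N, forall m n, (N <= m)%N -> (N <= n)%N ->
     nm (u m - u n) < e) ->
  exists x, tends u x.
Proof.
move=> cu.
have : cvg (u @ \oo).
  apply: cauchy_cvg; apply/cauchy_exP => d d0.
  have dE : d = ((complex.Re d)%:C)%C by rewrite RRe_real // gtr0_real.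
  have Rd0 : 0 < complex.Re d by rewrite -ltcR -dE.
  have [N uN] := cu _ Rd0.
  exists (u N); exists N => // n /= Nn.
  by rewrite dE; apply/ball_nm => //; apply: uN.
move=> /cvg_ex[x ux]; exists x => e e0.
have /ux[N _ uN] : nbhs x [set y | nm (x - y) < e] by apply/nbhs_nm; exists e.
by exists N => n /uN /=; rewrite nmB.
Qed.

Lemma small_eq0 (r : R) : (forall e, 0 < e -> r < e) -> r <= 0.
Proof.
by move=> h; rewrite leNgt; apply/negP => r0; have := h _ r0; rewrite ltxx.
Qed.

Lemma tends_unique u x y : tends u x -> tends u y -> x = y.
Proof.
move=> ux uy; apply/eqP; rewrite -subr_eq0; apply/eqP/nm_eq0/eqP.
rewrite eq_le nm_ge0 andbT; apply: small_eq0 => e e0.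
have e2 : 0 < e / 2 by rewrite divr_gt0.
have [N uN] := ux _ e2; have [M uM] := uy _ e2.
have := uN _ (leq_maxl N M); have := uM _ (leq_maxr N M).
by have := nm_subD x (u (maxn N M)) y; rewrite (nmB x (u _)); lra.
Qed.

Lemma tends_eq (u v : nat -> A) x N :
  (forall n, (N <= n)%N -> u n = v n) -> tends u x -> tends v x.
Proof.
move=> uv ux e e0; have [M uM] := ux _ e0; exists (maxn N M) => n.
by rewrite geq_max => /andP[Nn Mn]; rewrite -uv // uM.
Qed.

Lemma tends_cst x : tends (fun=> x) x.
Proof. by move=> e e0; exists 0%N => n _; rewrite subrr nm0. Qed.

Lemma tendsD u v x y : tends u x -> tends v y -> tends (fun n => u n + v n) (x + y).
Proof.
move=> ux vy e e0; have e2 : 0 < e / 2 by rewrite divr_gt0.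
have [N uN] := ux _ e2; have [M uM] := vy _ e2.
exists (maxn N M) => n; rewrite geq_max => /andP[/uN ? /uM ?].
by rewrite opprD addrACA (le_lt_trans (nmD _ _)) // (splitr e) ltrD.
Qed.

Lemma tendsMl u x y : tends u x -> tends (fun n => y * u n) (y * x).
Proof.
move=> ux e e0.
have y1 : 0 < nm y + 1 by rewrite ltr_wpDl ?nm_ge0.
have [N uN] := ux _ (divr_gt0 e0 y1); exists N => n /uN.
rewrite ltr_pdivlMr // => /(le_lt_trans _); apply.
rewrite -mulrBr (le_trans (nmM _ _)) // mulrC ler_wpM2l ?nm_ge0 //.
by rewrite lerDl.
Qed.

Lemma tends_star u x : tends u x -> tends (fun n => star (u n)) (star x).
Proof.
by move=> ux e /ux[N uN]; exists N => n /uN; rewrite -starB nm_star.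
Qed.

Lemma tendsMr u x y : tends u x -> tends (fun n => u n * y) (x * y).
Proof.
move=> /tends_star /(@tendsMl _ _ (star y)) /tends_star h.
move=> e /h[N uN]; exists N => n /uN.
by rewrite !starMr !starK.
Qed.

Lemma tendsZ u x c : tends u x -> tends (fun n => c *: u n) (c *: x).
Proof.
move=> ux e e0.
have c1 : 0 < complex.Re `|c| + 1.
  by rewrite ltr_wpDl // -ler0c RRe_real ?normr_real.
have [N uN] := ux _ (divr_gt0 e0 c1); exists N => n /uN.
rewrite ltr_pdivlMr // => /(le_lt_trans _); apply.
by rewrite -scalerBr nmZ mulrC ler_wpM2l ?nm_ge0 // lerDl.
Qed.

Lemma tends_nm u x r : tends u x -> (forall n, nm (u n) <= r) -> nm x <= r.
Proof.
move=> ux ur; rewrite -subr_le0; apply: small_eq0 => e e0.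
have [N uN] := ux _ e0; have := uN N (leqnn _); have := ur N.
have := nmD (x - u N) (u N); rewrite subrK nmB; lra.
Qed.

Lemma tendsM u v x y : tends u x -> tends v y -> tends (fun n => u n * v n) (x * y).
Proof.
move=> ux vy e e0.
have e2 : 0 < e / 2 by rewrite divr_gt0.
have [N1 vN] := tendsMl x vy e2.
have y1 : 0 < nm y + 1 by rewrite ltr_wpDl ?nm_ge0.
have [N2 vN2] := vy _ ltr01.
have [N3 uN] := ux _ (divr_gt0 e2 y1).
exists (maxn N1 (maxn N2 N3)) => n; rewrite !geq_max => /and3P[h1 h2 h3].
rewrite (le_lt_trans (nm_subD _ (x * v n) _)) // (splitr e) ltrD ?vN //.
rewrite -mulrBl (le_lt_trans (nmM _ _)) //.
have vn : nm (v n) <= nm y + 1.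
  by have := nmD (v n - y) y; rewrite subrK; have := vN2 _ h2; lra.
have := uN _ h3; rewrite ltr_pdivlMr //; apply: le_lt_trans.
by rewrite ler_wpM2l ?nm_ge0.
Qed.

End CStarNorm.
(** * States *)

Section States.
Context {R : realType} {A : cstarAlgebraType R}.
Implicit Types (x y z : A) (c : R[i]) (e : R) (S : set A) (g : A -> R[i]).

Lemma exp2_small e : 0 < e -> exists N, 2^-1 ^+ N < e.
Proof.
move=> e0; exists (Num.bound e^-1).
rewrite exprVn invf_plt ?posrE ?exprn_gt0 //.
exact: upper_nthrootP.
Qed.

Lemma half_double x : (2^-1 : R[i]) *: (x + x) = x.
Proof. by rewrite -[x + x]mulr2n -(scaler_nat _ x) scalerA mulVf ?scale1r ?pnatr_eq0. Qed.

Lemma nm_half x : nm ((2^-1 : R[i]) *: x) = 2^-1 * nm x.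
Proof.
rewrite nmZ ger0_norm ?invr_ge0 ?ler0n //; congr (_ * _).
have -> : (2^-1 : R[i]) = ((2^-1 : R)%:C)%C by rewrite fmorphV rmorph_nat.
by [].
Qed.

Lemma conj_half : (2^-1 : R[i])^* = 2^-1.
Proof. by apply/CrealP; rewrite realV realn. Qed.

(* [1 - y] is the fixed point of the contraction [w |-> (x + w^2) / 2] of the ball of radius 1/2. *)
Lemma sqrt_1B x : star x = x -> nm x <= 3 / 4 ->
  exists2 y, star y = y & 1 - x = y * y.
Proof.
move=> xs x34.
pose w := fix w n : A := if n is n'.+1 then (2^-1 : R[i]) *: (x + w n' * w n') else 0.
have w0 : w 0%N = 0 by [].
have wS n : w n.+1 = (2^-1 : R[i]) *: (x + w n * w n) by [].
(* (3/4 + 1/4) / 2 = 1/2: this is the origin of the bound 3/4 on [nm x]. *)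
have wh n : nm (w n) <= 2^-1.
  elim: n => [|n IH]; first by rewrite w0 nm0.
  rewrite wS nm_half; have := nmD x (w n * w n); have := nmM (w n) (w n).
  have := nm_ge0 (w n); nra.
have ws n : star (w n) = w n.
  elim: n => [|n IH]; first by rewrite w0 star0.
  by rewrite wS starZ starD starMr IH xs conj_half.
(* Squaring is 1-Lipschitz on the ball of radius 1/2, and the factor [2^-1] then halves the distance
   at each step. *)
have wd m n : nm (w (m + n)%N - w m) <= 2^-1 ^+ m.
  elim: m => [|m IH]; first by rewrite w0 subr0 expr0 (le_trans (wh _)) // invf_le1 ?ler1n.
  rewrite addSn !wS -scalerBr nm_half exprS ler_pM2l ?invr_gt0 ?ltr0n //.
  apply: le_trans IH; set u := w (m + n)%N; set v := w m.
  rewrite opprD addrACA subrr add0r.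
  have -> : u * u - v * v = u * (u - v) + (u - v) * v.
    by rewrite mulrBr mulrBl addrA subrK.
  rewrite (le_trans (nmD _ _)) //.
  have := nmM u (u - v); have := nmM (u - v) v; have := wh (m + n)%N; have := wh m.
  rewrite -/u -/v; have := nm_ge0 (u - v); nra.
have [l wl] : exists l, tends w l.
  apply: cauchy_tends => e e0.
  have [N Ne] := exp2_small (divr_gt0 e0 (ltr0n R 2)).
  exists N => m n Nm Nn; rewrite -(subnKC Nm) -(subnKC Nn).
  have := nm_subD (w (N + (m - N))%N) (w N) (w (N + (n - N))%N).
  have := wd N (m - N)%N; have := wd N (n - N)%N; rewrite (nmB (w N)); lra.
have ls : star l = l.
  apply: tends_unique (tends_star wl) _.
  by apply: (tends_eq (N := 0%N)) wl => n _; rewrite ws.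
have lE : l = (2^-1 : R[i]) *: (x + l * l).
  have wl1 : tends (fun n => w n.+1) l.
    by move=> e /wl[N wN]; exists N => n Nn; apply: wN; rewrite ltnW.
  apply: tends_unique wl1 _; apply: tendsZ; apply: tendsD; first exact: tends_cst.
  exact: tendsM.
have l2 : l + l = x + l * l by rewrite {1 2}lE -scalerDr half_double.
exists (1 - l); first by rewrite starB star1 ls.
rewrite mulrBr mulr1 mulrBl mul1r opprB addrA addrAC -addrA.
have -> : x = l + l - l * l by rewrite l2 addrK.
by rewrite !opprD opprK !addrA.
Qed.

(** An affine function bounded below on the whole line has slope zero; this is the degenerate case
    of the discriminant argument for Cauchy-Schwarz. *)
Lemma affine_ge0 (K c : R[i]) : (forall s : R, 0 <= K + (s%:C)%C * c) -> c = 0.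
Proof.
case: K c => [k k'] [a b] h.
have := h 0; have := h 1; rewrite !lecE /= !mul0r !mul1r ?mul0r ?subr0 ?addr0 ?add0r.
move=> /andP[/eqP h1 _] /andP[/eqP h2 _].
have b0 : b = 0 by move: h1; rewrite h2 add0r.
have [->|a0] := eqVneq a 0; first by rewrite b0.
(* At this point the real part would be -1. *)
have {h} := h (- (k + 1) / a); rewrite lecE /= b0 => /andP[_].
rewrite ?mul0r ?mulr0 ?subr0 divfK // => ?; exfalso; lra.
Qed.

Section State.
Variables (S : set A) (g : A -> R[i]).
Hypothesis gS : state_on S g.

Lemma state0 : S 0 -> g 0 = 0.
Proof.
case: gS => gl _ _ S0; have := gl 1 _ _ S0 S0.
by rewrite scale1r addr0 mul1r => /esym/eqP; rewrite addrC -subr_eq0 addrK => /eqP.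
Qed.

Lemma stateD x y : S x -> S y -> g (x + y) = g x + g y.
Proof. by case: gS => gl _ _ Sx Sy; rewrite -[x in LHS]scale1r gl // mul1r. Qed.

Lemma stateZ c x : S 0 -> S x -> g (c *: x) = c * g x.
Proof.
by case: gS => gl _ _ S0 Sx; rewrite -[c *: x]addr0 gl // state0 // addr0.
Qed.

Lemma state_pos x : S x -> 0 <= g (star x * x).
Proof. by case: gS => _ + _; apply. Qed.

Lemma state1 : g 1 = 1. Proof. by case: gS. Qed.

End State.

Section FullState.
Variable g : A -> R[i].
Hypothesis gT : state_on setT g.

Let gD x y : g (x + y) = g x + g y. Proof. exact: (stateD gT). Qed.
Let gZ c x : g (c *: x) = c * g x. Proof. exact: (stateZ gT). Qed.
Let gN x : g (- x) = - g x. Proof. by rewrite -scaleN1r gZ mulN1r. Qed.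

Lemma full_stateB x y : g (x - y) = g x - g y. Proof. by rewrite gD gN. Qed.

Lemma full_state_sum (I : Type) (s : seq I) (F : I -> A) :
  g (\sum_(i <- s) F i) = \sum_(i <- s) g (F i).
Proof. by apply: (big_morph _ gD); apply: (state0 gT). Qed.

(** Both [1 - x] and [1 + x] are squares of self-adjoint elements by [sqrt_1B], so [g] is
    nonnegative on them. *)
Lemma state_bound_sa x : star x = x -> nm x <= 3 / 4 -> `|g x| <= 1.
Proof.
move=> xs x34.
have h y : star y = y -> nm y <= 3 / 4 -> g y <= 1.
  move=> ys /(sqrt_1B ys)[z zs zE].
  have : 0 <= g (star z * z) by apply: (state_pos gT).
  by rewrite zs -zE full_stateB (state1 gT) subr_ge0.
have hx := h _ xs x34.
have hy : -1 <= g x.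
  by rewrite lerNl -gN h ?nmN ?starN ?xs.
have xr : g x \is Num.real by rewrite (ler_real hx) rpred1.
by rewrite real_ler_norml // hy hx.
Qed.

(** States are defined without continuity; it is deduced here from positivity, with a crude
    constant, by splitting [x] into real and imaginary parts. *)
Lemma state_bound x r : 0 < r -> nm x <= r -> `|g x| <= (4 * r)%:C%C.
Proof.
move=> r0 xr.
have h y : star y = y -> nm y <= 2 * r -> `|g y| <= (4 * r)%:C%C.
  (* This factor brings [y], of norm at most [2 * r], into the ball of radius 1/2. *)
  move=> ys yr; pose t : R[i] := ((4 * r)^-1)%:C%C.
  have t0 : 0 < t by rewrite ltcR invr_gt0 mulr_gt0.
  have : `|g (t *: y)| <= 1.
    apply: state_bound_sa.
      by rewrite starZ ys; congr (_ *: _); apply: CrealP; rewrite gtr0_real.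
    rewrite nmZ gtr0_norm //= mulrC ler_pdivrMr ?mulr_gt0 //; lra.
  rewrite gZ normrM gtr0_norm // /t fmorphV mulrC ler_pdivrMr ?mul1r //.
  by rewrite ltcR mulr_gt0.
have ii : (-'i : R[i]) * 'i = 1 by rewrite mulNr -expr2 sqrCi opprK.
have xE : x = (2^-1 : R[i]) *: ((x + star x) + (- 'i) *: ('i *: (x - star x))).
  by rewrite scalerA ii scale1r addrACA subrr addr0 half_double.
rewrite xE gZ gD gZ normrM.
have h1 : `|g (x + star x)| <= (4 * r)%:C%C.
  apply: h; first by rewrite starD starK addrC.
  by rewrite (le_trans (nmD _ _)) // nm_star; lra.
have h2 : `|g ('i *: (x - star x))| <= (4 * r)%:C%C.
  apply: h.
    by rewrite starZ starB starK conjCi scaleNr -scalerN opprB.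
  rewrite nmZ normCi /= mul1r (le_trans (nmD _ _)) // nmN nm_star; lra.
rewrite ger0_norm ?invr_ge0 ?ler0n // mulrC ler_pdivrMr ?ltr0n //.
rewrite (le_trans (ler_normD _ _)) // normrM normrN normCi mul1r.
by rewrite (le_trans (lerD h1 h2)) // mulr_natr mulr2n.
Qed.

(** For null [y], the nonnegative value at [star (x + c *: y) * (x + c *: y)] has no quadratic term
    in [c]. Real [c] kill the sum of the two cross terms, imaginary [c] their difference. *)
Lemma state_null x y : g (star y * y) = 0 -> g (star x * y) = 0 /\ g (star y * x) = 0.
Proof.
move=> y0.
have h c : 0 <= g (star x * x) + (c * g (star x * y) + c^* * g (star y * x)).
  have := state_pos gT (x := x + c *: y) I.
  rewrite starD starZ mulrDl !mulrDr !scaleMl !scaleMr !gD !gZ y0 !mulr0 addr0.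
  by rewrite addrA.
have h1 : g (star x * y) + g (star y * x) = 0.
  apply: (@affine_ge0 (g (star x * x))) => s; rewrite mulrDr.
  have -> : (s%:C)%C * g (star y * x) = (s%:C)%C^* * g (star y * x).
    by congr (_ * _); apply/esym/CrealP/complex_realP; exists s.
  exact: h.
have h2 : 'i * (g (star x * y) - g (star y * x)) = 0.
  apply: (@affine_ge0 (g (star x * x))) => s.
  have := h ((s%:C)%C * 'i); rewrite rmorphM /= conjCi.
  have -> : ((s%:C)%C : R[i])^* = (s%:C)%C by apply/CrealP/complex_realP; exists s.
  by rewrite mulrN mulNr mulrBr mulrBr !mulrA.
move/eqP: h2; rewrite mulf_eq0 (negPf (neq0Ci _)) /= subr_eq0 => /eqP h2.
move: h1; rewrite h2 -mulr2n => /eqP; rewrite mulrn_eq0 /= => /eqP h1.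
by rewrite h1.
Qed.

End FullState.
End States.
(** * The diagonal of a tower of orthogonal projections *)

Section DiagonalOfTower.
Context {R : realType} {A : cstarAlgebraType R}.
Variables (An : nat -> set A) (I : nat -> finType) (e : forall n, I n -> A).
Arguments e : clear implicits.
Implicit Types (x y a b w : A) (c : R[i]) (n m : nat).

Definition compression n x := \sum_i e n i * x * e n i.
Local Notation Q := compression.

(* At most one nonzero block in each row and each column. *)
Definition monomial n w :=
  (forall i j j', e n i * w * e n j != 0 -> e n i * w * e n j' != 0 -> j = j') /\
  (forall i i' j, e n i * w * e n j != 0 -> e n i' * w * e n j != 0 -> i = i').

Hypothesis AnM : forall n a b, An n a -> An n b -> An n (a * b).
Hypothesis AnStar : forall n a, An n a -> An n (star a).
Hypothesis AnS : forall n a, An n a -> An n.+1 a.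
Hypothesis AnDense : forall x, approx [set a | exists n, An n a] x.
Hypothesis eAn : forall n i, An n (e n i).
Hypothesis eStar : forall n i, star (e n i) = e n i.
Hypothesis eM : forall n i j, e n i * e n j = if i == j then e n i else 0.
Hypothesis eSum : forall n, \sum_i e n i = 1.
Hypothesis eComm : forall n i a b, An n a -> An n b ->
  (e n i * a * e n i) * (e n i * b * e n i) = (e n i * b * e n i) * (e n i * a * e n i).
Hypothesis QS : forall n a, An n a -> Q n.+1 a = Q n a.
Hypothesis monoS : forall n w, An n w -> monomial n w -> monomial n.+1 w.
(** This and the next three hypotheses are the analytic input from a single level. No constant in
    them depends on [n], which is what allows them to pass to the completion. *)
Hypothesis Qsqrt : forall n a, An n a ->
  exists2 b, An n b & Q n (star a * a) = Q n (star b * b) * Q n (star b * b).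
Hypothesis Qsqrt_lip : forall n a b, An n a -> An n b ->
  nm (Q n (star a * a) - Q n (star b * b)) ^+ 2 <=
  nm (Q n (star a * a) * Q n (star a * a) - Q n (star b * b) * Q n (star b * b)).
Hypothesis QCS : forall n a b, An n a -> An n b ->
  nm (Q n (star a * b)) ^+ 2 <= nm (Q n (star a * a)) * nm (Q n (star b * b)).
Hypothesis nm_lowerQ : forall n a (r : R), An n a -> 0 <= r -> r < nm a ->
  exists2 u, An n u /\ nm u <= 1 & r ^+ 2 <= nm (Q n (star (a * u) * (a * u))).

(** * Compression by one family of projections *)

Lemma tower_le n m a : (n <= m)%N -> An n a -> An m a.
Proof.
move=> /subnKC <- Aa.
by elim: (m - n)%N => [|k IH]; rewrite ?addn0 // addnS; apply: AnS.
Qed.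

Lemma compression_stable n m a : (n <= m)%N -> An n a -> Q m a = Q n a.
Proof.
move=> /subnKC <- Aa; elim: (m - n)%N => [|k IH]; rewrite ?addn0 // addnS QS //.
by apply: tower_le Aa; rewrite leq_addr.
Qed.

Lemma tower_projection_idem n i : e n i * e n i = e n i. Proof. by rewrite eM eqxx. Qed.

Lemma tower_projection_orth n i j : i != j -> e n i * e n j = 0.
Proof. by rewrite eM => /negPf ->. Qed.

Lemma compressionD n x y : Q n (x + y) = Q n x + Q n y.
Proof. by rewrite -big_split; apply: eq_bigr => i _; rewrite mulrDr mulrDl. Qed.

Lemma compressionZ n c x : Q n (c *: x) = c *: Q n x.
Proof. by rewrite /Q scaler_sumr; apply: eq_bigr => i _; rewrite scaleMr scaleMl. Qed.

Lemma compressionB n x y : Q n (x - y) = Q n x - Q n y.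
Proof. by rewrite compressionD -scaleN1r compressionZ scaleN1r. Qed.

Lemma compression_adj n x : Q n (star x) = star (Q n x).
Proof. by rewrite star_sum; apply: eq_bigr => i _; rewrite !starMr eStar mulrA. Qed.

Lemma mul_compression n i x : e n i * Q n x = e n i * x * e n i.
Proof.
rewrite mulr_sumr (bigD1 i) //= big1 ?addr0 => [|j ji].
  by rewrite !mulrA tower_projection_idem.
by rewrite !mulrA tower_projection_orth 1?eq_sym // !mul0r.
Qed.

Lemma compression_mul n i x : Q n x * e n i = e n i * x * e n i.
Proof.
rewrite mulr_suml (bigD1 i) //= big1 ?addr0 => [|j ji].
  by rewrite -!mulrA tower_projection_idem.
by rewrite -!mulrA tower_projection_orth // !mulr0.
Qed.

Lemma compression_id n x : (forall i, e n i * x = x * e n i) -> Q n x = x.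
Proof.
move=> h; rewrite -[RHS]mulr1 -(eSum n) mulr_sumr; apply: eq_bigr => i _.
by rewrite h -mulrA tower_projection_idem.
Qed.

Lemma compression_bimodule n x y z : (forall i, e n i * x = x * e n i) ->
  (forall i, e n i * z = z * e n i) -> Q n (x * y * z) = x * Q n y * z.
Proof.
move=> xe ze; rewrite mulr_sumr mulr_suml; apply: eq_bigr => i _.
by rewrite !mulrA xe -!mulrA ze.
Qed.

(* Compressing by [p] and [1 - p] is averaging over conjugation by the symmetry [1 - 2 p]. *)
Lemma nm_pinch p x : star p = p -> p * p = p ->
  nm (p * x * p + (1 - p) * x * (1 - p)) <= nm x.
Proof.
move=> ps pp; pose u := 1 - (p + p).
have us : star u = u by rewrite starB starD star1 ps.
have uu : u * u = 1.
  have ss : (p + p) * (p + p) = (p + p) + (p + p) by rewrite mulrDl !mulrDr !pp.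
  by rewrite /u mulrBr mulr1 mulrBl mul1r ss opprB addrK subrK.
have nu : nm u <= 1.
  by rewrite -(@expr_le1 _ 2) ?nm_ge0 // -nm_cstar us uu nm1.
set q := 1 - p.
have -> : p * x * p + q * x * q = (2^-1 : R[i]) *: (x + u * x * u).
  rewrite -[LHS]half_double; congr (_ *: _).
  have pq : p + q = 1 by rewrite addrC subrK.
  have qp : q - p = u by rewrite /q /u opprD addrA.
  have xE : x = p * x * p + q * x * q + (p * x * q + q * x * p).
    rewrite -[LHS]mul1r -[LHS]mulr1 -pq mulrDr !mulrDl.
    by rewrite [X in _ + X]addrC addrACA [X in _ + X]addrC.
  have uE : u * x * u = p * x * p + q * x * q - (p * x * q + q * x * p).
    by rewrite -qp mulrBr !mulrBl opprB addrACA -opprD [X in X - _]addrC.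
  by rewrite [X in _ = X + _]xE uE [RHS]addrACA subrr addr0.
rewrite nm_half.
have := nmD x (u * x * u); have := nmM (u * x) u; have := nmM u x.
have := nm_ge0 x; have := nm_ge0 u; have := nm_ge0 (u * x); nra.
Qed.

(** Induction on a list of indices: splitting one more projection off the complement of those
    already used is a single [nm_pinch]. Once all are used the complement is 0. *)
Lemma nm_compression n x : nm (Q n x) <= nm x.
Proof.
have main (l : seq (I n)) : uniq l ->
    nm (\sum_(i <- l) e n i * x * e n i +
        (1 - \sum_(i <- l) e n i) * x * (1 - \sum_(i <- l) e n i)) <= nm x.
  elim: l => [|i l IH] /=; first by rewrite !big_nil subr0 mul1r mulr1 add0r.
  move=> /andP[il /IH]; apply: le_trans.
  rewrite !big_cons; set f := 1 - \sum_(j <- l) e n j; set S := \sum_(j <- l) _.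
  have ij j : j \in l -> i != j by apply: contraTneq => <-.
  have iS : e n i * S = 0.
    rewrite mulr_sumr big_seq big1 // => j /ij ji.
    by rewrite !mulrA tower_projection_orth // !mul0r.
  have Si : S * e n i = 0.
    rewrite mulr_suml big_seq big1 // => j /ij ji.
    by rewrite -!mulrA tower_projection_orth 1?eq_sym // !mulr0.
  have if_ : e n i * f = e n i.
    rewrite mulrBr mulr1 mulr_sumr big_seq big1 ?subr0 // => j /ij ji.
    by rewrite tower_projection_orth.
  have fi : f * e n i = e n i.
    rewrite mulrBl mul1r mulr_suml big_seq big1 ?subr0 // => j /ij ji.
    by rewrite tower_projection_orth // eq_sym.
  have := nm_pinch (S + f * x * f) (eStar i) (tower_projection_idem i).
  have -> : e n i * (S + f * x * f) * e n i = e n i * x * e n i.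
    by rewrite mulrDr iS add0r !mulrA if_ -mulrA fi.
  have -> : (1 - e n i) * (S + f * x * f) * (1 - e n i) =
            S + (f - e n i) * x * (f - e n i).
    rewrite [(1 - e n i) * (_ + _)]mulrDr mulrDl; congr (_ + _).
      by rewrite mulrBl mul1r iS subr0 mulrBr mulr1 Si subr0.
    by rewrite !mulrA mulrBl mul1r if_ -mulrA mulrBr mulr1 fi.
  have -> : 1 - (e n i + \sum_(j <- l) e n j) = f - e n i.
    by rewrite opprD addrA addrAC.
  by rewrite addrA.
have := main _ (index_enum_uniq (I n)).
by rewrite eSum subrr mulr0 addr0.
Qed.

(** The compressions are uniformly contractive and eventually constant on each [An n], hence Cauchy
    at every point of the closure. *)
Lemma compression_cvg x : exists l, tends (compression ^~ x) l.
Proof.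
apply: cauchy_tends => r r0.
have [a [N Aa] xa] := AnDense x (divr_gt0 r0 (ltr0n R 2)).
exists N => m n Nm Nn.
have h k : (N <= k)%N -> nm (Q k x - Q N a) < r / 2.
  move=> Nk; rewrite -(compression_stable Nk Aa) -compressionB.
  exact: le_lt_trans (nm_compression _ _) xa.
have := nm_subD (Q m x) (Q N a) (Q n x).
by have := h _ Nm; have := h _ Nn; rewrite (nmB (Q n x)); lra.
Qed.

(** * The limit expectation and its range *)

Definition expectation x : A := projT1 (cid (compression_cvg x)).
Local Notation P := expectation.

Lemma expectation_tends x : tends (compression ^~ x) (P x).
Proof. exact: projT2 (cid (compression_cvg x)). Qed.

Lemma expectation_eq x l : tends (compression ^~ x) l -> P x = l.
Proof. exact: tends_unique (expectation_tends x). Qed.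

Lemma expectation_tower n a : An n a -> P a = Q n a.
Proof.
move=> Aa; apply: expectation_eq; apply: (tends_eq (N := n)) (tends_cst _) => m nm_.
by rewrite (compression_stable nm_ Aa).
Qed.

Lemma expectationD x y : P (x + y) = P x + P y.
Proof.
apply: expectation_eq.
apply: (tends_eq (N := 0%N)) (tendsD (expectation_tends x) (expectation_tends y)).
by move=> n _; rewrite compressionD.
Qed.

Lemma expectationZ c x : P (c *: x) = c *: P x.
Proof.
apply: expectation_eq; apply: (tends_eq (N := 0%N)) (tendsZ c (expectation_tends x)).
by move=> n _; rewrite compressionZ.
Qed.

Lemma expectationB x y : P (x - y) = P x - P y.
Proof. by rewrite expectationD -scaleN1r expectationZ scaleN1r. Qed.

Lemma expectation_sum (J : Type) (s : seq J) (F : J -> A) :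
  P (\sum_(j <- s) F j) = \sum_(j <- s) P (F j).
Proof. by apply: (big_morph _ expectationD); rewrite -(scale0r (0 : A)) expectationZ !scale0r. Qed.

Lemma nm_expectation x : nm (P x) <= nm x.
Proof. by apply: tends_nm (expectation_tends x) _ => n; apply: nm_compression. Qed.

Lemma tends_expectation u x : tends u x -> tends (fun n => P (u n)) (P x).
Proof.
move=> ux r /ux[N uN]; exists N => n /uN.
by rewrite -expectationB; apply: le_lt_trans (nm_expectation _).
Qed.

Definition diagonal : set A := [set x | forall n i, e n i * x = x * e n i].
Local Notation D := diagonal.

Lemma expectation_id x : D x -> P x = x.
Proof.
move=> Dx; apply: expectation_eq; apply: (tends_eq (N := 0%N)) (tends_cst _) => n _.
by rewrite compression_id.
Qed.

(** For [n <= m] stability gives [Q m (e n i) = Q n (e n i) = e n i], so [e n i] is block diagonal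
    for the finer family. *)
Lemma tower_projection_comm n m i j : e n i * e m j = e m j * e n i.
Proof.
wlog nm_ : n m i j / (n <= m)%N => [hw|].
  by have [/hw|/ltnW/hw] := leqP n m => ->.
have en : Q m (e n i) = e n i.
  rewrite (compression_stable nm_) //; apply: compression_id => k; rewrite !eM eq_sym.
  by case: eqP => // ->.
by rewrite -en mul_compression compression_mul.
Qed.

Lemma diagonal_projection n i : D (e n i).
Proof. by move=> m j; rewrite tower_projection_comm. Qed.

Lemma diagonal_limit u x : tends u x -> (forall n, D (u n)) -> D x.
Proof.
move=> ux Du n i; apply: tends_unique (tendsMl _ ux) _.
by apply: (tends_eq (N := 0%N)) (tendsMr _ ux) => m _; rewrite Du.
Qed.

Lemma approx_seq (S : set A) x : approx S x ->
  exists2 u, tends u x & forall n, S (u n).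
Proof.
move=> Sx.
have h n : exists y, S y /\ nm (x - y) < 2^-1 ^+ n.
  have [|y Sy xy] := Sx (2^-1 ^+ n); last by exists y.
  by rewrite exprn_gt0 // invr_gt0 ltr0n.
have [u uP] := choice h.
exists u; last by move=> n; have [] := uP n.
move=> r r0; have [N Nr] := exp2_small r0; exists N => n Nn.
rewrite nmB; have [_ un] := uP n; apply: lt_trans un (le_lt_trans _ Nr).
by rewrite ler_wiXn2l // ?invr_ge0 ?invf_le1 ?ler1n ?ler0n ?ltr0n.
Qed.

Lemma tower_seq_approx x : exists2 u, tends u x & forall n, exists m, An m (u n).
Proof. exact: approx_seq (AnDense x). Qed.

Lemma compressionM n a b : Q n a * Q n b = \sum_i (e n i * a * e n i) * (e n i * b * e n i).
Proof.
rewrite mulr_suml; apply: eq_bigr => i _.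
rewrite -[LHS]mulrA mul_compression -(mulrA _ b) !mulrA.
by rewrite -(mulrA _ (e n i) (e n i)) tower_projection_idem.
Qed.

(** At a common level both [Q n a] and [e m j] are compressions, so their product is computed inside
    the corners [e k i * A_k * e k i], which are commutative by [eComm]. *)
Lemma diagonal_compression n a : An n a -> D (Q n a).
Proof.
move=> Aa m j; rewrite -(compression_stable (leq_maxl n m) Aa).
set k := maxn n m.
have <- : Q k (e m j) = e m j by rewrite compression_id // => i; rewrite tower_projection_comm.
rewrite !compressionM; apply: eq_bigr => i _; rewrite eComm //.
  by apply: tower_le (eAn j); rewrite leq_maxr.
by apply: tower_le Aa; rewrite leq_maxl.
Qed.

Lemma expectation_diagonal x : D (P x).
Proof.
have [u ux Au] := tower_seq_approx x; apply: diagonal_limit (tends_expectation ux) _ => n.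
by have [m Am] := Au n; rewrite (expectation_tower Am); apply: diagonal_compression.
Qed.

Lemma diagonal_sub_algebra : sub_cstar_algebra D.
Proof.
split.
- apply: approx_closed => x /approx_seq[u ux Du]; exact: diagonal_limit ux Du.
- by move=> n i; rewrite mulr0 mul0r.
- move=> x y Dx Dy; split=> n i; first by rewrite mulrDr mulrDl Dx Dy.
  by rewrite cmulE mulrA Dx -mulrA Dy mulrA.
- by move=> c x Dx n i; rewrite scaleMr scaleMl Dx.
- by move=> x Dx n i; rewrite -{1}(eStar i) -starMr -Dx starMr eStar.
Qed.

(** An element of [D] is its own expectation, hence a limit of compressions of tower elements; two
    such compressions commute at a common level. *)
Lemma diagonal_abelian x y : D x -> D y -> x * y = y * x.
Proof.
have h z : D z -> forall n a, An n a -> Q n a * z = z * Q n a.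
  move=> Dz n a Aa; have [u uz Au] := tower_seq_approx z.
  have Pz := tends_expectation uz; rewrite expectation_id // in Pz.
  apply: tends_unique (tendsMl _ Pz) _.
  apply: (tends_eq (N := 0%N)) (tendsMr _ Pz) => k _.
  have [m Am] := Au k; rewrite (expectation_tower Am).
  rewrite -(compression_stable (leq_maxl n m) Aa).
  rewrite -(compression_stable (leq_maxr n m) Am) !compressionM.
  apply: eq_bigr => i _; rewrite eComm //.
    by apply: tower_le Am; rewrite leq_maxr.
  by apply: tower_le Aa; rewrite leq_maxl.
move=> Dx Dy; have [u ux Au] := tower_seq_approx x.
have Px := tends_expectation ux; rewrite expectation_id // in Px.
apply: tends_unique (tendsMr y Px) _.
apply: (tends_eq (N := 0%N)) (tendsMl y Px) => k _.
by have [m Am] := Au k; rewrite (expectation_tower Am) h.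
Qed.

Lemma diagonal_maximal_abelian : maximal_abelian D.
Proof.
split=> [x y|B' _ abB' DB' x B'x n i]; first exact: diagonal_abelian.
by apply: abB' => //; apply/DB'/diagonal_projection.
Qed.

Lemma expectation_bimodule x y z : D x -> D z -> P (x * y * z) = x * P y * z.
Proof.
move=> Dx Dz; apply: expectation_eq.
apply: (tends_eq (N := 0%N)) (tendsMr z (tendsMl x (expectation_tends y))) => n _.
by rewrite compression_bimodule.
Qed.

(** * Monomial elements and regularity *)

Lemma monomial_star n w : monomial n w -> monomial n (star w).
Proof.
have h i j : e n i * star w * e n j = star (e n j * w * e n i).
  by rewrite !starMr !eStar mulrA.
have s0 x : star x != 0 -> x != 0 by apply: contraNneq => ->; rewrite star0.
by move=> [r c]; split=> i j k; rewrite !h => /s0 ? /s0 ?; [apply: c|apply: r]; eassumption.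
Qed.

Lemma monomial_col n w j : monomial n w -> exists i, w * e n j = e n i * w * e n j.
Proof.
move=> [_ wc].
have wE : w * e n j = \sum_i e n i * w * e n j.
  by rewrite -[LHS]mul1r -(eSum n) mulr_suml; apply: eq_bigr => i _; rewrite mulrA.
have [[i wi]|h] := pselect (exists i, e n i * w * e n j != 0).
  exists i; rewrite wE (bigD1 i) //= big1 ?addr0 // => k ki.
  by apply/eqP; apply: contraNT ki => wk; apply/eqP; apply: wc wk wi.
(* The column is zero, so any row index would serve. *)
exists j; rewrite wE big1 => [|i _].
  by apply/esym/eqP; apply: contra_notT h => ?; exists j.
by apply/eqP; apply: contra_notT h => ?; exists i.
Qed.

Lemma offdiag_comm n x : (forall i j, i != j -> e n i * x * e n j = 0) ->
  forall i, e n i * x = x * e n i.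
Proof.
move=> h i; transitivity (e n i * x * e n i).
  rewrite -[LHS]mulr1 -(eSum n) mulr_sumr (bigD1 i) //= big1 ?addr0 // => j ji.
  by rewrite h // eq_sym.
rewrite -[RHS]mul1r -(eSum n) mulr_suml (bigD1 i) //= big1 ?addr0 ?mulrA // => j ji.
by rewrite mulrA h.
Qed.

(** Columns [j] and [j'] of [w] sit in single rows [i] and [i']. Block diagonality of [x] forces
    [i = i'] in a nonzero block of the product, and the row condition then forces [j = j']. *)
Lemma monomial_conj n w x : monomial n w -> (forall i, e n i * x = x * e n i) ->
  forall i, e n i * (star w * x * w) = star w * x * w * e n i.
Proof.
move=> mw xe; apply: offdiag_comm => j j' jj'.
have [i wi] := monomial_col j mw; have [i' wi'] := monomial_col j' mw.
have swi : e n j * star w = e n j * star w * e n i.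
  by have := congr1 star wi; rewrite !starMr !eStar mulrA.
rewrite !mulrA swi -mulrA wi' !mulrA.
rewrite -(mulrA _ (e n i) x) xe mulrA.
rewrite -(mulrA _ (e n i) (e n i')) eM; case: eqP => [ii'|]; last by rewrite !(mulr0, mul0r).
have [w0|w0] := eqVneq (e n i * w * e n j) 0.
  by rewrite swi -[e n j * _ * _]mulrA -(eStar j) -{1}(eStar i) -!starMr w0 star0 !mul0r.
have [w1|w1] := eqVneq (e n i' * w * e n j') 0.
  by rewrite ii' -!mulrA (mulrA (e n i')) w1 !mulr0.
by move/eqP: jj'; case; apply: (proj1 mw) w0 _; rewrite ii'.
Qed.

(** Both sides are block diagonal, and the [j]-th block sees only the diagonal block of [x] at the
    row of column [j], which [x] shares with [Q n x]. *)
Lemma compression_monomial n w x : monomial n w -> Q n (star w * x * w) = star w * Q n x * w.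
Proof.
move=> mw; rewrite -[RHS](compression_id (n := n)); last first.
  by apply: monomial_conj => // i; rewrite mul_compression compression_mul.
apply: eq_bigr => j _; have [i wi] := monomial_col j mw.
have swi : e n j * star w = e n j * star w * e n i.
  by have := congr1 star wi; rewrite !starMr !eStar mulrA.
rewrite !mulrA -(mulrA _ w) -[in RHS](mulrA _ w) wi swi !mulrA.
congr (_ * w * _).
have /(congr1 ( *%R (e n j * star w))) : e n i * Q n x * e n i = e n i * x * e n i.
  by rewrite mul_compression -mulrA tower_projection_idem.
by rewrite !mulrA => ->.
Qed.

(** Since [P] is a limit of compressions, being monomial at all large levels suffices for [P] to
    commute with conjugation by [w]. *)
Definition tail_monomial w := exists N, forall m, (N <= m)%N -> monomial m w.

Lemma expectation_monomial w x : tail_monomial w -> P (star w * x * w) = star w * P x * w.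
Proof.
move=> [N mw]; apply: expectation_eq.
apply: (tends_eq (N := N)) (tendsMr w (tendsMl (star w) (expectation_tends x))) => n Nn.
by rewrite compression_monomial //; apply: mw.
Qed.

Lemma diagonal_monomial w x : tail_monomial w -> D x -> D (star w * x * w).
Proof.
move=> tw Dx; have := expectation_diagonal (star w * x * w).
by rewrite expectation_monomial // expectation_id.
Qed.

Lemma tail_monomial_star w : tail_monomial w -> tail_monomial (star w).
Proof. by move=> [N h]; exists N => m Nm; apply: monomial_star; apply: h. Qed.

Lemma tail_monomial_normalizer w : tail_monomial w -> normalizers D w.
Proof.
move=> tw x Dx; split; last exact: diagonal_monomial.
by have := diagonal_monomial (tail_monomial_star tw) Dx; rewrite starK.
Qed.

Lemma tail_monomial_block n i j a : An n a -> tail_monomial (e n i * a * e n j).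
Proof.
move=> Aa; exists n => m /subnKC <-.
have Aw : An n (e n i * a * e n j) by apply: AnM => //; apply: AnM.
elim: (m - n)%N => [|k IH]; last first.
  by rewrite addnS; apply: monoS (tower_le _ Aw) IH; rewrite leq_addr.
rewrite addn0; split=> [k l l'|k k' l]; rewrite !mulrA.
- have [->|jl] := eqVneq j l; last by rewrite -!mulrA tower_projection_orth // !mulr0 eqxx.
  by have [->//|jl'] := eqVneq l l'; rewrite -!mulrA (tower_projection_orth jl') !mulr0 eqxx.
- have [->|jl] := eqVneq k i; last by rewrite tower_projection_orth // !mul0r eqxx.
  by have [->//|jl'] := eqVneq k' i; rewrite (tower_projection_orth jl') !mul0r eqxx.
Qed.

Lemma block_sum n x : x = \sum_i \sum_j e n i * x * e n j.
Proof.
rewrite -[LHS]mul1r -(eSum n) mulr_suml; apply: eq_bigr => i _.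
by rewrite -[LHS]mulr1 -(eSum n) mulr_sumr.
Qed.

Lemma diagonal_regular : generates (normalizers D).
Proof.
move=> S [cS S0 SDM _ _] NS; apply/seteqP; split=> // x _.
apply: (closed_approx cS) => r r0; have [a [n Aa] xa] := AnDense x r0.
exists a => //; rewrite (block_sum n a).
have SD y z : S y -> S z -> S (y + z) by move=> Sy Sz; have [] := SDM _ _ Sy Sz.
apply: (big_ind S) => // i _; apply: (big_ind S) => // j _.
by apply/NS/tail_monomial_normalizer/tail_monomial_block.
Qed.

(** Approximants of [x] have square roots on their levels, and [Qsqrt_lip] makes these roots Cauchy.
    The result gives positivity of [P] and of the composite of a state of [D] with [P]. *)
Lemma expectation_sqrt x : exists2 d : A, D d /\ star d = d & P (star x * x) = d * d.
Proof.
have [u ux Au] := tower_seq_approx x.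
have Pu := tends_expectation (tendsM (tends_star ux) ux).
have h k : exists d : A, exists m a, [/\ An m a, d = Q m (star a * a) &
    P (star (u k) * u k) = d * d].
  have [m Am] := Au k; have [b Ab bE] := Qsqrt Am.
  exists (Q m (star b * b)), m, b; split=> //.
  by rewrite (expectation_tower (n := m)) //; apply: AnM => //; apply: AnStar.
have [c cP] := choice h.
have cs k : star (c k) = c k.
  by have [m [a [_ -> _]]] := cP k; rewrite -compression_adj starMr starK.
have cD k : D (c k).
  by have [m [a [Aa -> _]]] := cP k; apply/diagonal_compression/AnM => //; apply: AnStar.
(* The two roots come from different levels; stability of compressions moves both to the larger one,
   where the estimate applies. *)
have clip k l : nm (c k - c l) ^+ 2 <=
    nm (P (star (u k) * u k) - P (star (u l) * u l)).
  have [m [a [Aa ca ->]]] := cP k; have [m' [b [Ab cb ->]]] := cP l.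
  have Aaa : An m (star a * a) by apply/AnM => //; apply: AnStar.
  have Abb : An m' (star b * b) by apply/AnM => //; apply: AnStar.
  rewrite ca cb -(compression_stable (leq_maxl m m') Aaa) -(compression_stable (leq_maxr m m') Abb).
  by apply: Qsqrt_lip; [apply: tower_le Aa; rewrite leq_maxl|apply: tower_le Ab; rewrite leq_maxr].
have [l cl] : exists l, tends c l.
  apply: cauchy_tends => r r0.
  have r2 : 0 < r ^+ 2 / 2 by rewrite divr_gt0 ?exprn_gt0.
  have [N uN] := Pu _ r2; exists N => m n Nm Nn.
  rewrite -(ltr_pXn2r (n := 2)) ?nnegrE ?nm_ge0 ?(ltW r0) //.
  apply: le_lt_trans (clip m n) _.
  have := nm_subD (P (star (u m) * u m)) (P (star x * x)) (P (star (u n) * u n)).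
  have := uN _ Nm; have := uN _ Nn; rewrite (nmB (P (star x * x))); lra.
exists l; first split.
- exact: diagonal_limit cl cD.
- by apply: tends_unique (tends_star cl) _; apply: (tends_eq (N := 0%N)) cl => n _; rewrite cs.
- apply: tends_unique Pu _; apply: (tends_eq (N := 0%N)) (tendsM cl cl) => k _.
  by have [m [a [_ _ ->]]] := cP k.
Qed.

(** The Cauchy-Schwarz inequality of the levels is applied to approximants: one factor tends to 0,
    the other stays below [B]. *)
Lemma expectation_null x y : P (star x * x) = 0 -> P (star x * y) = 0.
Proof.
move=> x0; have [u ux Au] := tower_seq_approx x; have [v vy Av] := tower_seq_approx y.
have Puu := tends_expectation (tendsM (tends_star ux) ux); rewrite x0 in Puu.
have Pvv := tends_expectation (tendsM (tends_star vy) vy).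
have Puv := tends_expectation (tendsM (tends_star ux) vy).
have CS k : nm (P (star (u k) * v k)) ^+ 2 <=
    nm (P (star (u k) * u k)) * nm (P (star (v k) * v k)).
  have [m Am] := Au k; have [m' Am'] := Av k.
  have {}Am : An (maxn m m') (u k) by apply: tower_le Am; rewrite leq_maxl.
  have {}Am' : An (maxn m m') (v k) by apply: tower_le Am'; rewrite leq_maxr.
  rewrite !(expectation_tower (n := maxn m m')); try by apply: AnM => //; apply: AnStar.
  exact: QCS.
apply: nm_eq0; apply/eqP; rewrite eq_le nm_ge0 andbT; apply: small_eq0 => r r0.
set B := nm (P (star y * y)) + 1.
have B0 : 0 < B by rewrite ltr_wpDl ?nm_ge0.
have [N1 h1] := Puu _ (divr_gt0 (exprn_gt0 2 (divr_gt0 r0 (ltr0n R 2))) B0).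
have [N2 h2] := Pvv _ ltr01.
have [N3 h3] := Puv _ (divr_gt0 r0 (ltr0n R 2)).
set k := maxn N1 (maxn N2 N3).
have {h1} := h1 k (leq_maxl _ _); rewrite subr0 ltr_pdivlMr // => h1.
have {h2} h2 : nm (P (star (v k) * v k)) <= B.
  have := h2 k (leq_trans (leq_maxl _ _) (leq_maxr _ _)).
  have := nmD (P (star (v k) * v k) - P (star y * y)) (P (star y * y)).
  by rewrite subrK /B; lra.
have {}h3 := h3 k (leq_trans (leq_maxr _ _) (leq_maxr _ _)).
have h4 : nm (P (star (u k) * v k)) < r / 2.
  rewrite -(ltr_pXn2r (n := 2)) ?nnegrE ?nm_ge0 ?divr_ge0 ?(ltW r0) //.
  apply: le_lt_trans (CS k) (le_lt_trans _ h1).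
  by rewrite ler_wpM2l ?nm_ge0.
have := nmD (P (star x * y) - P (star (u k) * v k)) (P (star (u k) * v k)).
by rewrite subrK (nmB (P (star x * y))); lra.
Qed.

Lemma expectation_faithful x : P (star x * x) = 0 -> x = 0.
Proof.
move=> x0; apply: nm_eq0; apply/eqP; apply: contraT => nx.
have d0 : 0 < nm x by rewrite lt_def nx nm_ge0.
(* With 1/8 the norm of [a] exceeds 3/4 of that of [x]. The difference of expectations is then at
   least (3/4)^2 = 36/64 but at most 9/64 + 8/64, in units of [nm x ^+ 2]. *)
have [a [n Aa] xa] := AnDense x (divr_gt0 d0 (ltr0n R 8)).
have na : 7 / 8 * nm x <= nm a.
  by have := nmD (x - a) a; rewrite subrK; lra.
have na' : nm a <= 9 / 8 * nm x.
  by have := nmD (a - x) x; rewrite subrK nmB; lra.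
have [||u [Au u1] ua] := @nm_lowerQ n a (3 / 4 * nm x) Aa; first lra; first lra.
have Pxu : P (star (x * u) * (x * u)) = 0.
  (* Only the left factor is split: for each block [w] of [u], [P] kills [star (x * w) * (x * w)],
     hence by [expectation_null] also [star (x * w)] times anything. *)
  rewrite {1}(block_sum n u) mulr_sumr star_sum mulr_suml expectation_sum big1 // => i _.
  rewrite mulr_sumr star_sum mulr_suml expectation_sum big1 // => j _.
  apply: expectation_null; set w := _ * _ * _.
  have -> : star (x * w) * (x * w) = star w * (star x * x) * w by rewrite starMr !mulrA.
  by rewrite expectation_monomial ?x0 ?mulr0 ?mul0r //; apply: tail_monomial_block.
have Aau : An n (a * u) by apply: AnM.
have : (3 / 4 * nm x) ^+ 2 <= nm (P (star (a * u) * (a * u)) - P (star (x * u) * (x * u))).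
  by rewrite Pxu subr0 (expectation_tower (n := n)) //; apply: AnM => //; apply: AnStar.
rewrite -expectationB => h; have {}h := le_trans h (nm_expectation _).
set y := a * u in h; set z := x * u in h.
have yz : nm (y - z) <= nm x / 8.
  rewrite -mulrBl (le_trans (nmM _ _)) // nmB.
  by have := nm_ge0 u; have := nm_ge0 (x - a); nra.
have ny : nm y <= 9 / 8 * nm x.
  by rewrite (le_trans (nmM _ _)) //; have := nm_ge0 u; have := nm_ge0 a; nra.
have nz : nm z <= nm x.
  by rewrite (le_trans (nmM _ _)) //; have := nm_ge0 u; have := nm_ge0 x; nra.
have yzE : star y * y - star z * z = star y * (y - z) + star (y - z) * z.
  by rewrite starB mulrBr mulrBl addrA subrK.
have := nmM (star y) (y - z); have := nmM (star (y - z)) z.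
have := nmD (star y * (y - z)) (star (y - z) * z).
rewrite -yzE !nm_star => h1 h2 h3.
have := nm_ge0 y; have := nm_ge0 z; have := nm_ge0 (y - z) => p1 p2 p3.
have : nm y * nm (y - z) <= (9 / 8 * nm x) * (nm x / 8) by apply: ler_pM.
have : nm (y - z) * nm z <= (nm x / 8) * nm x by apply: ler_pM.
have : 0 < nm x ^+ 2 by rewrite exprn_gt0.
by rewrite exprMn expr2 in h *; nra.
Qed.

Lemma diagonal_cartan : cartan_subalgebra D.
Proof.
split; [exact: diagonal_sub_algebra|exact: diagonal_maximal_abelian|exact: diagonal_regular|].
exists P; split; last exact: expectation_faithful.
split.
- by move=> c x y; rewrite expectationD expectationZ.
- by split; [exact: expectation_diagonal|exact: expectation_id].
- by move=> x; rewrite !nmE lecR nm_expectation.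
- by move=> _ [y ->]; have [c [_ cs] cE] := expectation_sqrt y; exists c; rewrite cmulE cE cs.
- by move=> b c x Db Dc; rewrite expectation_bimodule.
Qed.

(** * Pure states of the diagonal *)

Lemma diagonal0 : D 0. Proof. by case: diagonal_sub_algebra. Qed.

Lemma diagonal1 : D 1. Proof. by move=> n i; rewrite mulr1 mul1r. Qed.

Lemma diagonalM x y : D x -> D y -> D (x * y).
Proof. by case: diagonal_sub_algebra => _ _ h _ _ Dx Dy; have [] := h _ _ Dx Dy. Qed.

Lemma diagonalN x : D x -> D (- x).
Proof. by case: diagonal_sub_algebra => _ _ _ h _ Dx; rewrite -scaleN1r; apply: h. Qed.

(** Conditioning [f] on [p]; positivity uses that [D] is abelian, so that [p * (star x * x)] is
    [star (p * x) * (p * x)]. *)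
Lemma cut_state (f : A -> R[i]) p (t : R) : state_on D f -> D p -> star p = p ->
  p * p = p -> f p = (t%:C)%C -> 0 < t ->
  state_on D (fun x => (t^-1%:C)%C * f (p * x)).
Proof.
move=> fD Dp ps pp fp t0.
have tt : (t^-1%:C)%C * (t%:C)%C = 1 :> R[i].
  by rewrite -rmorphM mulVf ?gt_eqF.
split=> [c x y Dx Dy|x Dx|].
- rewrite mulrDr scaleMr; case: fD => fl _ _.
  by rewrite fl ?mulrDr //; [rewrite mulrCA|exact: diagonalM..].
- rewrite mulr_ge0 ?lecR ?invr_ge0 ?(ltW t0) //.
  have -> : p * cmul (star x) x = star (p * x) * (p * x).
    have Dsx : D (star x) by case: diagonal_sub_algebra => _ _ _ _; apply.
    rewrite cmulE starMr ps [RHS]mulrA -(mulrA (star x)) pp.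
    by rewrite (diagonal_abelian Dsx Dp) -mulrA.
  by apply: (state_pos fD); apply: diagonalM.
- by rewrite coneE mulr1 fp.
Qed.

(** Otherwise [f] is a proper convex combination of its conditionings on [p] and [1 - p]; by purity
    it equals the first, whose value at [p] is 1. *)
Lemma pure_projection (f : A -> R[i]) p : pure_state_on D f -> D p -> star p = p ->
  p * p = p -> f p = 0 \/ f p = 1.
Proof.
move=> [fD fpure] Dp ps pp.
have Dq : D (1 - p).
  by move=> n i; rewrite mulrBr mulrBl mulr1 mul1r Dp.
have qs : star (1 - p) = 1 - p by rewrite starB star1 ps.
have qq : (1 - p) * (1 - p) = 1 - p.
  by rewrite mulrBr mulr1 mulrBl mul1r pp subrr subr0.
have f0 : 0 <= f p by rewrite -pp -{1}ps; apply: (state_pos fD).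
have fq0 : 0 <= f (1 - p) by rewrite -qq -{1}qs; apply: (state_pos fD).
have fq : f (1 - p) = 1 - f p.
  rewrite (stateD fD diagonal1); last exact: diagonalN.
  by rewrite (state1 fD) -scaleN1r (stateZ fD _ diagonal0) // mulN1r.
pose t := complex.Re (f p).
have ft : f p = (t%:C)%C by rewrite RRe_real // ger0_real.
have ft' : f (1 - p) = ((1 - t)%:C)%C by rewrite fq ft rmorphB.
move: f0 fq0; rewrite ft ft' !ler0c => t0; rewrite subr_ge0 => t1.
have [->|tn0] := eqVneq t 0; first by left.
have [->|tn1] := eqVneq t 1; first by right.
have tp : 0 < t by rewrite lt_def tn0.
have tq : 0 < 1 - t by rewrite subr_gt0 lt_def eq_sym tn1.
have Sp := cut_state fD Dp ps pp ft tp.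
have Sq := cut_state fD Dq qs qq ft' tq.
have [|x Dx|] := fpure _ _ t Sp Sq _ _ p Dp.
- by rewrite tp -subr_gt0.
- rewrite !mulrA -!rmorphM !mulfV ?gt_eqF // !mul1r -(stateD fD); [|exact: diagonalM..].
  by rewrite -mulrDl addrC subrK mul1r.
by rewrite pp ft -rmorphM mulVf // => <-; right.
Qed.

Lemma pure_extension_eq (f g : A -> R[i]) : pure_state_on D f -> state_on setT g ->
  (forall b, D b -> g b = f b) -> forall x, g x = f (P x).
Proof.
move=> fD gT gf x; rewrite -gf; last exact: expectation_diagonal.
have key n a : An n a -> g a = g (P a).
  move=> Aa; rewrite (expectation_tower Aa) {1}(block_sum n a) !(full_state_sum gT).
  apply: eq_bigr => i _; rewrite (full_state_sum gT) (bigD1 i) //= big1 ?addr0 // => j ji.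
  have g0 k : g (e n k) = 0 \/ g (e n k) = 1.
    rewrite gf; last exact: diagonal_projection.
    exact: (pure_projection fD (diagonal_projection k) (eStar k) (tower_projection_idem k)).
  have gnull k : g (e n k) = 0 -> forall y, g (e n k * y) = 0 /\ g (y * e n k) = 0.
    move=> gk y; have gk' : g (star (e n k) * e n k) = 0 by rewrite eStar tower_projection_idem.
    have [_] := state_null gT y gk'; have [] := state_null gT (star y) gk'.
    by rewrite starK eStar.
  have [/gnull h|gi] := g0 i; first by rewrite -mulrA; case: (h (a * e n j)).
  have [/gnull h|gj] := g0 j; first by case: (h (e n i * a)).
  (* Two projections of value 1 would push the sum of all values, which is 1, to at least 2. *)
  have : g (\sum_k e n k) = 1 by rewrite eSum (state1 gT).
  rewrite (full_state_sum gT) (bigD1 i) //= (bigD1 j) //= gi gj.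
  rewrite -[RHS]addr0 => /addrI.
  set S := \sum_(k | _) _ => S1.
  have S0 : 0 <= S.
    by apply: sumr_ge0 => k _; have [->|->] := g0 k; rewrite ?ler01.
  by have := ltr_wpDr S0 (ltr01 : 0 < 1 :> R[i]); rewrite S1 ltxx.
have [u ux Au] := tower_seq_approx x.
apply/eqP; rewrite -subr_eq0 -(full_stateB gT) -normr_eq0 eq_le normr_ge0 andbT.
(* As [g] and its composite with [P] agree on the tower, [x - P x] may be exchanged for an
   arbitrarily small element. *)
have gE k : g (x - P x) = g ((x - u k) - P (x - u k)).
  have [m Am] := Au k.
  have g0 : g (u k - P (u k)) = 0 by rewrite (full_stateB gT) (key _ _ Am) subrr.
  rewrite expectationB -[LHS]subr0 -g0 -(full_stateB gT); congr g.
  by rewrite !opprD !opprK !addrA [x - u k - _]addrAC.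
have h r : 0 < r -> `|g (x - P x)| <= (4 * r)%:C%C.
  move=> r0; have [N uN] := ux _ (divr_gt0 r0 (ltr0n R 2)).
  rewrite (gE N) (state_bound gT) //.
  have := uN N (leqnn _); have := nmD (x - u N) (- P (x - u N)).
  by have := nm_expectation (x - u N); rewrite nmN (nmB x); lra.
set z := `|_| in h *.
have zE : z = ((complex.Re z)%:C)%C by rewrite RRe_real // normr_real.
rewrite zE lecR; apply: small_eq0 => r r0.
(* 4 * (r / 8) is r / 2, strictly below r. *)
have := h (r / 8) (divr_gt0 r0 (ltr0n R 8)); rewrite {1}zE lecR; lra.
Qed.

Lemma diagonal_unique_extension : unique_pure_state_extension D.
Proof.
move=> f fD; exists (fun x => f (P x)); split; last first.
  by move=> g [gT gf]; apply/funext => x; rewrite (pure_extension_eq fD gT gf).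
have [fS _] := fD; split; last by move=> b Db; rewrite expectation_id.
split=> [c x y _ _|x _|].
- rewrite expectationD expectationZ; case: fS => fl _ _; apply: fl; exact: expectation_diagonal.
- have [c [Dc cs] cE] := expectation_sqrt x; rewrite cmulE cE -{1}cs.
  exact: (state_pos fS).
- by rewrite coneE expectation_id ?(state1 fS) //; exact: diagonal1.
Qed.

Lemma diagonal_cstar_diagonal : cstar_diagonal D.
Proof. by split; [exact: diagonal_cartan|exact: diagonal_unique_extension]. Qed.

End DiagonalOfTower.
(** * The operator norm of matrices *)

Section MatrixNorm.
Context {R : realType}.
Local Notation C := R[i].

Definition adj m n (M : 'M[C]_(m, n)) : 'M[C]_(n, m) := M ^t*.

Lemma adjE m n (M : 'M[C]_(m, n)) i j : adj M i j = (M j i)^*.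
Proof. by rewrite !mxE. Qed.

Lemma adjK m n (M : 'M[C]_(m, n)) : adj (adj M) = M.
Proof. by apply/matrixP => i j; rewrite !adjE conjCK. Qed.

Lemma adjM m n p (M : 'M[C]_(m, n)) (N : 'M[C]_(n, p)) : adj (M *m N) = adj N *m adj M.
Proof. by rewrite /adj trmx_mul map_mxM. Qed.

Lemma adjD m n (M N : 'M[C]_(m, n)) : adj (M + N) = adj M + adj N.
Proof. by apply/matrixP => i j; rewrite !mxE rmorphD. Qed.

Lemma adj0 m n : adj (0 : 'M[C]_(m, n)) = 0.
Proof. by apply/matrixP => i j; rewrite !mxE conjC0. Qed.

Lemma adjZ m n (c : C) (M : 'M[C]_(m, n)) : adj (c *: M) = c^* *: adj M.
Proof. by apply/matrixP => i j; rewrite !mxE rmorphM. Qed.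

Lemma adj_sum m n (I : Type) (s : seq I) (F : I -> 'M[C]_(m, n)) :
  adj (\sum_(i <- s) F i) = \sum_(i <- s) adj (F i).
Proof. by apply: (big_morph (@adj m n)); [exact: adjD|exact: adj0]. Qed.

Lemma adj_tens m n p q (M : 'M[C]_(m, n)) (N : 'M[C]_(p, q)) :
  adj (tensmx M N) = tensmx (adj M) (adj N).
Proof. by apply/matrixP => i j; rewrite !mxE rmorphM. Qed.

Definition dot n (u v : 'cV[C]_n) : C := (adj u *m v) 0 0.

Lemma dotE n (u v : 'cV[C]_n) : dot u v = \sum_i (u i 0)^* * v i 0.
Proof. by rewrite /dot mxE; apply: eq_bigr => i _; rewrite adjE. Qed.

Lemma norm2_ge0 n (v : 'cV[C]_n) : 0 <= norm2 v.
Proof. exact: sqrtr_ge0. Qed.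

Lemma dot_norm2 n (v : 'cV[C]_n) : dot v v = (norm2 v ^+ 2)%:C%C.
Proof.
rewrite sqr_sqrtr; last by apply: sumr_ge0 => i _; rewrite sqr_ge0.
rewrite dotE rmorph_sum; apply: eq_bigr => i _.
by rewrite -normCKC -{1}(RRe_real (normr_real (v i 0))) rmorphXn.
Qed.

Lemma dotDr n (u v w : 'cV[C]_n) : dot u (v + w) = dot u v + dot u w.
Proof. by rewrite /dot mulmxDr mxE. Qed.

Lemma dotDl n (u v w : 'cV[C]_n) : dot (v + w) u = dot v u + dot w u.
Proof. by rewrite /dot adjD mulmxDl mxE. Qed.

Lemma dotZr n c (u v : 'cV[C]_n) : dot u (c *: v) = c * dot u v.
Proof. by rewrite /dot -scalemxAr mxE. Qed.

Lemma dotZl n c (u v : 'cV[C]_n) : dot (c *: u) v = c^* * dot u v.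
Proof. by rewrite /dot adjZ -scalemxAl mxE. Qed.

Lemma dotC n (u v : 'cV[C]_n) : dot v u = (dot u v)^*.
Proof. by rewrite /dot -adjE adjM adjK. Qed.

Lemma dot_adj m n (M : 'M[C]_(m, n)) u v : dot u (M *m v) = dot (adj M *m u) v.
Proof. by rewrite /dot adjM adjK mulmxA. Qed.

Lemma norm2_eq0 n (v : 'cV[C]_n) : norm2 v = 0 -> v = 0.
Proof.
move=> v0; have := dot_norm2 v; rewrite v0 expr0n /= => /eqP.
rewrite dotE psumr_eq0 => [/allP h|i _]; last by rewrite -normCKC exprn_ge0.
apply/matrixP => i j; rewrite ord1 mxE; have := h i (mem_index_enum i).
by rewrite -normCKC expf_eq0 normr_eq0 => /eqP.
Qed.

Lemma dot_CS n (u v : 'cV[C]_n) : `|dot u v| <= (norm2 u * norm2 v)%:C%C.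
Proof.
have [/norm2_eq0 ->|u0] := eqVneq (norm2 u) 0.
  by rewrite /dot adj0 mul0mx mxE normr0 lecR mulr_ge0 ?norm2_ge0.
have nn : 0 <= (norm2 u * norm2 v)%:C%C by rewrite ler0c mulr_ge0 ?norm2_ge0.
rewrite -(ler_pXn2r (n := 2)) ?nnegrE ?normr_ge0 //.
have -> : ((norm2 u * norm2 v)%:C%C : C) ^+ 2 = dot u u * dot v v.
  by rewrite !dot_norm2 -rmorphM -exprMn rmorphXn.
set U := dot u u; set V := dot v v; set a := dot u v.
have Up : 0 < U by rewrite /U dot_norm2 ltcR exprn_even_gt0.
have UR : U^* = U by apply/CrealP; rewrite gtr0_real.
(* This is [U] times the part of [v] orthogonal to [u]; its square norm is [U * (U * V - |a|^2)]. *)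
have : 0 <= dot (U *: v - a *: u) (U *: v - a *: u).
  by rewrite dot_norm2 ler0c exprn_ge0 ?norm2_ge0.
rewrite -scaleNr dotDl !dotDr !dotZl !dotZr -/U -/V -/a (dotC u v) -/a UR rmorphN.
have -> : U * (U * V) + U * (- a * a^*) + (- a^* * (U * a) + - a^* * (- a * U)) =
          U * (U * V - a * a^*) by ring.
by rewrite pmulr_rge0 // subr_ge0 normCK.
Qed.

Lemma norm2D n (u v : 'cV[C]_n) : norm2 (u + v) <= norm2 u + norm2 v.
Proof.
rewrite -(ler_pXn2r (n := 2)) ?nnegrE ?addr_ge0 ?norm2_ge0 //.
rewrite -lecR -dot_norm2 dotDl !dotDr (dotC u v) !dot_norm2.
set a := dot u v.
have aa : a + a^* <= 2 * (norm2 u * norm2 v)%:C%C.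
  have ar : a + a^* \is Num.real by apply/CrealP; rewrite rmorphD /= conjCK addrC.
  rewrite (le_trans (real_ler_norm ar)) // (le_trans (ler_normD _ _)) //.
  rewrite norm_conjC; have -> : `|a| + `|a| = 2 * `|a| by ring.
  by rewrite ler_pM2l ?dot_CS // ltr0n.
set U := (norm2 u ^+ 2)%:C%C; set V := (norm2 v ^+ 2)%:C%C.
have -> : U + a + (a^* + V) = (a + a^*) + (U + V) by ring.
have -> : ((norm2 u + norm2 v) ^+ 2)%:C%C = 2 * (norm2 u * norm2 v)%:C%C +
   ((norm2 u ^+ 2)%:C%C + (norm2 v ^+ 2)%:C%C).
  rewrite -rmorphD -(rmorph_nat (real_complex R)) -rmorphM -rmorphD.
  by congr (_%:C)%C; ring.
by rewrite lerD2r.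
Qed.

Lemma norm2Z n (c : C) (v : 'cV[C]_n) : norm2 (c *: v) = complex.Re `|c| * norm2 v.
Proof.
rewrite /norm2 (eq_bigr (fun i => (complex.Re `|c|) ^+ 2 * (complex.Re `|v i 0|) ^+ 2)).
  rewrite -mulr_sumr sqrtrM ?sqr_ge0 // sqrtr_sqr ger0_norm //.
  by rewrite -ler0c RRe_real ?normr_real.
move=> i _; rewrite mxE normrM -exprMn; congr (_ ^+ 2).
by rewrite -{1}(RRe_real (normr_real c)) -{1}(RRe_real (normr_real (v i 0))) -rmorphM.
Qed.

Lemma norm20 n : norm2 (0 : 'cV[C]_n) = 0.
Proof. by rewrite -(scale0r (0 : 'cV[C]_n)) norm2Z normr0 mul0r. Qed.

Lemma norm2_sum n (I : Type) (s : seq I) (F : I -> 'cV[C]_n) :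
  norm2 (\sum_(i <- s) F i) <= \sum_(i <- s) norm2 (F i).
Proof.
elim/big_rec2: _ => [|i u x _ le_x]; first by rewrite norm20.
by rewrite (le_trans (norm2D _ _)) // lerD2l.
Qed.

Lemma norm2_delta n (j : 'I_n) : norm2 (delta_mx j 0 : 'cV[C]_n) = 1.
Proof.
rewrite /norm2 (bigD1 j) // big1 => [|i ij].
  rewrite mxE !eqxx andbb mulr1n normr1.
  by have -> : complex.Re (1 : C) = 1 by []; rewrite expr1n /= addr0 sqrtr1.
rewrite mxE (negPf ij) andFb mulr0n normr0.
by have -> : complex.Re (0 : C) = 0 by []; rewrite expr0n.
Qed.

Lemma norm2_entry n (v : 'cV[C]_n) i : complex.Re `|v i 0| <= norm2 v.
Proof.
rewrite -(ler_pXn2r (n := 2)) ?nnegrE ?norm2_ge0 //; last first.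
  by rewrite -ler0c RRe_real ?normr_real.
rewrite sqr_sqrtr; last by apply: sumr_ge0 => k _; rewrite sqr_ge0.
by rewrite (bigD1 i) //= lerDl sumr_ge0 // => k _; rewrite sqr_ge0.
Qed.

(** [sup] returns 0 on an unbounded set, so [op_norm] means nothing before boundedness is known. *)
Lemma op_norm_has_sup n (M : 'M[C]_n) :
  has_sup [set norm2 (M *m v) | v in [set v | norm2 v <= 1]].
Proof.
split; first by exists (norm2 (M *m 0)), 0 => //=; rewrite norm20 ler01.
exists (\sum_j norm2 (col j M)) => _ [v /= v1 <-].
have -> : M *m v = \sum_j v j 0 *: col j M.
  apply/matrixP => i k; rewrite ord1 !mxE summxE; apply: eq_bigr => j _.
  by rewrite !mxE mulrC.
rewrite (le_trans (norm2_sum _ _)) //; apply: ler_sum => j _; rewrite norm2Z.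
by rewrite ler_piMl ?norm2_ge0 // (le_trans (norm2_entry v j)).
Qed.

Lemma op_normP n (M : 'M[C]_n) v : norm2 (M *m v) <= op_norm M * norm2 v.
Proof.
have h w : norm2 w <= 1 -> norm2 (M *m w) <= op_norm M.
  by move=> w1; apply: ub_le_sup; [exact: (proj2 (op_norm_has_sup M))|exists w].
have [v0|v0] := eqVneq (norm2 v) 0.
  by rewrite v0 (norm2_eq0 v0) mulmx0 norm20 mulr0.
have vp : 0 < norm2 v by rewrite lt_def v0 norm2_ge0.
pose t : C := ((norm2 v)^-1)%:C%C.
have tn : complex.Re `|t| = (norm2 v)^-1.
  by rewrite ger0_norm // ler0c invr_ge0 norm2_ge0.
have := h (t *: v); rewrite -scalemxAr !norm2Z tn mulVf // => /(_ (lexx _)).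
by rewrite mulrC ler_pdivrMr.
Qed.

Lemma op_norm_ge0 n (M : 'M[C]_n) : 0 <= op_norm M.
Proof.
apply: (le_trans (norm2_ge0 (M *m 0))); apply: ub_le_sup.
  exact: (proj2 (op_norm_has_sup M)).
by exists 0 => //=; rewrite norm20 ler01.
Qed.

Lemma op_norm_le n (M : 'M[C]_n) r : 0 <= r ->
  (forall v, norm2 (M *m v) <= r * norm2 v) -> op_norm M <= r.
Proof.
move=> r0 h; apply: ge_sup; first exact: (proj1 (op_norm_has_sup M)).
move=> _ [v /= v1 <-]; rewrite (le_trans (h v)) //.
by rewrite ler_piMr.
Qed.

Lemma op_norm_gt n (M : 'M[C]_n) r : r < op_norm M ->
  exists2 v, norm2 v <= 1 & r < norm2 (M *m v).
Proof.
move=> rM; have [_ [v /= v1 <-] rv] := sup_gt (proj1 (op_norm_has_sup M)) rM.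
by exists v.
Qed.

Lemma op_normM n (M N : 'M[C]_n) : op_norm (M *m N) <= op_norm M * op_norm N.
Proof.
apply: op_norm_le => [|v]; first by rewrite mulr_ge0 ?op_norm_ge0.
rewrite -mulmxA (le_trans (op_normP _ _)) // -mulrA ler_wpM2l ?op_norm_ge0 //.
exact: op_normP.
Qed.

Lemma op_normD n (M N : 'M[C]_n) : op_norm (M + N) <= op_norm M + op_norm N.
Proof.
apply: op_norm_le => [|v]; first by rewrite addr_ge0 ?op_norm_ge0.
by rewrite mulmxDl mulrDl (le_trans (norm2D _ _)) // lerD // op_normP.
Qed.

Lemma op_norm0 n : op_norm (0 : 'M[C]_n) = 0.
Proof.
apply/eqP; rewrite eq_le op_norm_ge0 andbT; apply: op_norm_le => // v.
by rewrite mul0mx norm20 mul0r.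
Qed.

Lemma op_norm_sum n (I : Type) (s : seq I) (P : pred I) (F : I -> 'M[C]_n) :
  op_norm (\sum_(i <- s | P i) F i) <= \sum_(i <- s | P i) op_norm (F i).
Proof.
elim/big_rec2: _ => [|i u x _ le_x]; first by rewrite op_norm0.
by rewrite (le_trans (op_normD _ _)) // lerD2l.
Qed.

Lemma op_normZ_le n (c : C) (M : 'M[C]_n) : op_norm (c *: M) <= complex.Re `|c| * op_norm M.
Proof.
have c0 : 0 <= complex.Re `|c| by rewrite -ler0c RRe_real ?normr_real.
apply: op_norm_le => [|v]; first by rewrite mulr_ge0 ?op_norm_ge0.
by rewrite -scalemxAl norm2Z -mulrA ler_wpM2l // op_normP.
Qed.

Lemma op_norm_eq0 n (M : 'M[C]_n) : op_norm M = 0 -> M = 0.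
Proof.
move=> M0; apply/matrixP => i j; rewrite mxE.
have /norm2_eq0/matrixP/(_ i 0) : norm2 (M *m delta_mx j 0) = 0.
  by apply/eqP; rewrite eq_le norm2_ge0 andbT (le_trans (op_normP _ _)) // M0 mul0r.
by rewrite -colE !mxE.
Qed.

Lemma op_norm_entry n (M : 'M[C]_n) i j : complex.Re `|M i j| <= op_norm M.
Proof.
have := norm2_entry (M *m delta_mx j 0) i; rewrite -colE mxE => /le_trans; apply.
by rewrite colE (le_trans (op_normP _ _)) // norm2_delta mulr1.
Qed.

Lemma op_norm_cstar n (M : 'M[C]_n) : op_norm (adj M *m M) = op_norm M ^+ 2.
Proof.
have le1 (N : 'M[C]_n) : op_norm N ^+ 2 <= op_norm (adj N *m N).
  rewrite -(@sqr_sqrtr _ (op_norm (adj N *m N))) ?op_norm_ge0 //.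
  rewrite ler_pXn2r ?nnegrE ?op_norm_ge0 ?sqrtr_ge0 //.
  apply: op_norm_le => [|v]; first exact: sqrtr_ge0.
  rewrite -(ler_pXn2r (n := 2)) ?nnegrE ?mulr_ge0 ?sqrtr_ge0 ?norm2_ge0 //.
  rewrite exprMn (sqr_sqrtr (op_norm_ge0 _)) -lecR -dot_norm2 dot_adj.
  have d0 : 0 <= dot (adj N *m (N *m v)) v by rewrite -dot_adj dot_norm2 ler0c sqr_ge0.
  rewrite -(ger0_norm d0) (le_trans (dot_CS _ _)) // lecR expr2 mulrA mulmxA.
  by rewrite ler_wpM2r ?norm2_ge0 // op_normP.
have le2 (N : 'M[C]_n) : op_norm N <= op_norm (adj N).
  have [->|N0] := eqVneq (op_norm N) 0; first exact: op_norm_ge0.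
  have Np : 0 < op_norm N by rewrite lt_def N0 op_norm_ge0.
  by rewrite -(ler_pM2r Np) -[leLHS]expr2; apply: le_trans (le1 N) (op_normM _ _).
apply: le_anti; apply/andP; split; last exact: le1.
apply: le_trans (op_normM _ _) _; rewrite expr2.
by apply: ler_wpM2r; [exact: op_norm_ge0|rewrite -[in leRHS](adjK M); exact: le2].
Qed.

(** The power [2^k] of [M], as repeated squaring: for self-adjoint [M] the C*-identity computes its
    norm exactly. *)
Definition sqiter n k (M : 'M[C]_n) := iter k (fun X => X *m X) M.

Lemma sqiter_sa n k (M : 'M[C]_n) : adj M = M -> adj (sqiter k M) = sqiter k M.
Proof. by move=> Ms; elim: k => //= k IH; rewrite adjM IH. Qed.

Lemma op_norm_sqiter n k (M : 'M[C]_n) : adj M = M ->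
  op_norm (sqiter k M) = op_norm M ^+ (2 ^ k).
Proof.
move=> Ms; elim: k => [|k IH] /=; first by rewrite expn0 expr1.
by rewrite -{1}(sqiter_sa k Ms) op_norm_cstar IH expnS mulnC exprM.
Qed.

Lemma op_norm_proj_le1 n (M : 'M[C]_n) : adj M = M -> M *m M = M -> op_norm M <= 1.
Proof.
move=> Ms MM; have := op_norm_cstar M; rewrite Ms MM => h.
have [->|M0] := eqVneq (op_norm M) 0; first exact: ler01.
by rewrite -(mulfK M0 (op_norm M)) -expr2 -h mulfV.
Qed.

(* Removes the constant from an estimate between C*-norms, squared k times. *)
Lemma pow_bound_le (x r K : R) : 0 <= x -> 0 <= r -> 0 <= K ->
  (forall k, x ^+ (2 ^ k) <= K * r ^+ (2 ^ k)) -> x <= r.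
Proof.
move=> x0 r0 K0 h; rewrite leNgt; apply/negP => rx.
have xp : 0 < x by apply: le_lt_trans rx.
have [rz|rn0] := eqVneq r 0.
  by have := h 0%N; rewrite rz expn0 !expr1 mulr0 => /(lt_le_trans xp); rewrite ltxx.
have rp : 0 < r by rewrite lt_def rn0.
pose d := x / r - 1.
have d0 : 0 < d by rewrite subr_gt0 ltr_pdivlMr // mul1r.
(* Bernoulli's inequality: the powers of [x / r = 1 + d] outgrow [K]. *)
have bern k : 1 + k%:R * d <= (1 + d) ^+ k.
  elim: k => [|k IH]; first by rewrite mul0r addr0 expr0.
  rewrite exprS (le_trans _ (ler_wpM2l _ IH)) ?(addr_ge0 ler01 (ltW d0)) //.
  rewrite -[k.+1]addn1 natrD -subr_ge0.
  have -> : (1 + d) * (1 + k%:R * d) - (1 + (k%:R + 1%:R) * d) = k%:R * d ^+ 2 by ring.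
  by rewrite mulr_ge0 ?sqr_ge0.
pose N := Num.bound (K / d).
have Kd : K / d < N%:R by apply: archi_boundP; rewrite divr_ge0 // ltW.
have Kk : K < N%:R * d by rewrite -ltr_pdivrMr.
have : (1 + d) ^+ (2 ^ N) <= K.
  by rewrite /d addrC subrK exprMn exprVn ler_pdivrMr ?exprn_gt0.
apply/negP; rewrite -ltNge (lt_le_trans Kk) // (le_trans _ (bern _)) //.
rewrite (le_trans (_ : _ <= (2 ^ N)%:R * d)) ?lerDr ?ler01 //.
by rewrite ler_pM2r // ler_nat ltnW // ltn_expl.
Qed.

End MatrixNorm.
(** * Projections of rank at most one *)

Section MinimalProjections.
Context {R : realType}.
Local Notation C := R[i].

(** Rank at most one, zero included. The algebraic form is carried over by any *-isomorphism without
    speaking of ranks. *)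
Definition minimal_projection n (E : 'M[C]_n) :=
  [/\ adj E = E, E *m E = E & forall M, exists c, E *m M *m E = c *: E].

Lemma minimal_projectionP n (E : 'M[C]_n) : minimal_projection E -> E != 0 ->
  exists2 v : 'cV[C]_n, norm2 v = 1 & E = v *m adj v.
Proof.
move=> [Es EE E1] E0.
have [j wn0] : exists j, col j E != 0.
  apply: contraPP E0 => h; apply/negP; rewrite negbK; apply/eqP/matrixP => i j.
  have /eqP/matrixP/(_ i 0) : col j E == 0 by apply: contra_notT h => ?; exists j.
  by rewrite !mxE.
set w := col j E in wn0.
have Ew : E *m w = w by rewrite /w colE mulmxA EE.
have nw : norm2 w != 0 by apply: contraNneq wn0 => /norm2_eq0 ->.
pose v : 'cV[C]_n := ((norm2 w)^-1)%:C%C *: w.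
have nv : norm2 v = 1.
  by rewrite norm2Z ger0_norm ?ler0c ?invr_ge0 ?norm2_ge0 //= mulVf.
have Ev : E *m v = v by rewrite -scalemxAr Ew.
have vE : adj v *m E = adj v by rewrite -{1}Es -adjM Ev.
have vv : adj v *m v = 1%:M.
  by rewrite [LHS]mx11_scalar -/(dot v v) dot_norm2 nv expr1n.
(* The projection onto [v] lies in the corner of [E], hence is a multiple of [E]; as both fix [v],
   the factor is 1. *)
have [c cE] := E1 (v *m adj v).
have {}cE : v *m adj v = c *: E by rewrite -cE mulmxA Ev -mulmxA vE.
exists v => //.
have vc : v = c *: v.
  by rewrite -{2}Ev scalemxAl -cE -mulmxA vv mulmx1.
have c1 : c = 1.
  apply/eqP; rewrite -subr_eq0; have : (c - 1) *: v = 0.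
    by rewrite scalerBl scale1r -vc subrr.
  move=> /eqP; rewrite scaler_eq0 => /orP[//|/eqP v0].
  by move: nv; rewrite v0 norm20 => /esym/eqP; rewrite oner_eq0.
by rewrite cE c1 scale1r.
Qed.

Lemma tr_vv n (v : 'cV[C]_n) M : \tr (v *m adj v *m M) = dot v (M *m v).
Proof. by rewrite -mulmxA mxtrace_mulC -mulmxA /mxtrace big_ord1. Qed.

(** Makes the scalar canonical: as a trace it depends continuously on the base point. *)
Lemma minimal_tr n (E M : 'M[C]_n) : minimal_projection E ->
  E *m M *m E = \tr (E *m M) *: E.
Proof.
move=> mE; have [->|E0] := eqVneq E 0; first by rewrite !mul0mx scaler0.
have [v _ ->] := minimal_projectionP mE E0.
rewrite tr_vv.
have -> : v *m adj v *m M *m (v *m adj v) = v *m (adj v *m M *m v) *m adj v.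
  by rewrite !mulmxA.
by rewrite [adj v *m M *m v]mx11_scalar mul_mx_scalar -scalemxAl -mulmxA.
Qed.

Lemma minimal_of_rank1 n (E : 'M[C]_n) : adj E = E -> E *m E = E ->
  (\rank E <= 1)%N -> minimal_projection E.
Proof.
move=> Es EE rE; split=> // M.
move: (mulmx_base E); move: (col_base E) (row_base E).
case: (\rank E) rE => [_ u v|[|//] _ u v].
  by rewrite (flatmx0 v) mulmx0 => <-; exists 0; rewrite mulmx0 scaler0.
move=> uvE; exists ((v *m M *m u) 0 0).
rewrite -uvE; have -> : u *m v *m M *m (u *m v) = u *m (v *m M *m u) *m v.
  by rewrite !mulmxA.
by rewrite [in LHS](mx11_scalar (v *m M *m u)) mul_mx_scalar -scalemxAl.
Qed.

Lemma minimal0 n : minimal_projection (0 : 'M[C]_n).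
Proof. by split=> [||M]; rewrite ?adj0 ?mulmx0 //; exists 0; rewrite scaler0. Qed.

(** By linearity only matrix units matter; these are elementary tensors, on which both factors
    compress separately. *)
Lemma minimal_tens m n (E : 'M[C]_m) (F : 'M[C]_n) :
  minimal_projection E -> minimal_projection F -> minimal_projection (tensmx E F).
Proof.
move=> mE mF; have [Es EE _] := mE; have [Fs FF _] := mF.
split=> [||W]; first by rewrite adj_tens Es Fs.
  by rewrite tensmx_mul EE FF.
pose cc i j := \tr (E *m delta_mx (mxtens_unindex i).1 (mxtens_unindex j).1) *
               \tr (F *m delta_mx (mxtens_unindex i).2 (mxtens_unindex j).2).
exists (\sum_i \sum_j W i j * cc i j).
rewrite {1}[W]matrix_sum_delta mulmx_sumr mulmx_suml scaler_suml; apply: eq_bigr => i _.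
rewrite mulmx_sumr mulmx_suml scaler_suml; apply: eq_bigr => j _.
rewrite -scalemxAr -scalemxAl -[in RHS]scalerA; congr (_ *: _).
have -> : delta_mx i j = tensmx (delta_mx (mxtens_unindex i).1 (mxtens_unindex j).1)
                           (delta_mx (mxtens_unindex i).2 (mxtens_unindex j).2) :> 'M[C]_(m * n).
  apply/matrixP => k l; rewrite !mxE -natrM mulnb; congr (_%:R).
  rewrite -(can_eq (@mxtens_unindexK m n) k) -(can_eq (@mxtens_unindexK m n) l).
  by rewrite !xpair_eqE andbACA.
rewrite !tensmx_mul (minimal_tr _ mE) (minimal_tr _ mF).
by apply/matrixP => k l; rewrite !mxE mulrACA.
Qed.

Section DiagonalCombination.
Variables (n : nat) (I : finType) (E : I -> 'M[C]_n).
Hypothesis Emin : forall i, minimal_projection (E i).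
Hypothesis Eorth : forall i j, i != j -> E i *m E j = 0.

Lemma sum_minimal_proj :
  adj (\sum_i E i) = \sum_i E i /\ (\sum_i E i) *m (\sum_i E i) = \sum_i E i.
Proof.
split; first by rewrite adj_sum; apply: eq_bigr => i _; have [] := Emin i.
rewrite mulmx_suml; apply: eq_bigr => i _; rewrite mulmx_sumr (bigD1 i) //= big1.
  by rewrite addr0; have [] := Emin i.
by move=> j ji; rewrite Eorth // eq_sym.
Qed.

(** By Pythagoras and because the sum of the [E i] is a projection. Coefficients at vanishing [E i]
    are left unconstrained, as lines of the tower vanish at many points. *)
Lemma op_norm_diag_le (t : I -> C) r : 0 <= r ->
  (forall i, E i != 0 -> complex.Re `|t i| <= r) -> op_norm (\sum_i t i *: E i) <= r.
Proof.
move=> r0 h; apply: op_norm_le => // v.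
have Ev i : dot (E i *m v) v = ((norm2 (E i *m v)) ^+ 2)%:C%C.
  by have [Es EE _] := Emin i; rewrite -{1}EE -mulmxA -{1}Es -dot_adj dot_norm2.
have dot_suml (F : I -> 'cV[C]_n) : dot (\sum_i F i) v = \sum_i dot (F i) v.
  elim/big_rec2: _ => [|i x y _ <-]; last exact: dotDl.
  by rewrite /dot adj0 mul0mx mxE.
have [Ps PP] := sum_minimal_proj.
have sumE : \sum_i (norm2 (E i *m v)) ^+ 2 <= norm2 v ^+ 2.
  have : dot ((\sum_i E i) *m v) v = (\sum_i (norm2 (E i *m v)) ^+ 2)%:C%C.
    by rewrite mulmx_suml dot_suml rmorph_sum; apply: eq_bigr => i _; rewrite Ev.
  rewrite -{1}PP -mulmxA -{1}Ps -dot_adj dot_norm2 => /complexI <-.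
  rewrite ler_pXn2r ?nnegrE ?norm2_ge0 // (le_trans (op_normP _ _)) //.
  by rewrite ler_piMl ?norm2_ge0 // op_norm_proj_le1.
rewrite -(ler_pXn2r (n := 2)) ?nnegrE ?mulr_ge0 ?norm2_ge0 //.
rewrite -lecR -dot_norm2 dot_adj mulmxA.
have -> : adj (\sum_i t i *: E i) *m (\sum_i t i *: E i) = \sum_i `|t i| ^+ 2 *: E i.
  rewrite adj_sum mulmx_suml; apply: eq_bigr => i _; rewrite mulmx_sumr.
  have [Es EE _] := Emin i.
  rewrite (bigD1 i) //= big1 ?addr0 => [|j ji]; rewrite adjZ -scalemxAl -scalemxAr Es.
    by rewrite EE scalerA normCKC.
  by rewrite Eorth 1?eq_sym // !scaler0.
rewrite mulmx_suml dot_suml exprMn.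
apply: (@le_trans _ _ ((r ^+ 2 * \sum_i (norm2 (E i *m v)) ^+ 2)%:C%C)); last first.
  by rewrite lecR ler_wpM2l ?exprn_ge0.
have -> : (r ^+ 2 * \sum_i norm2 (E i *m v) ^+ 2)%:C%C =
    \sum_i (r%:C%C) ^+ 2 * (norm2 (E i *m v) ^+ 2)%:C%C :> C.
  by rewrite mulr_sumr rmorph_sum; apply: eq_bigr => i _; rewrite rmorphM rmorphXn.
apply: ler_sum => i _.
have [->|Ei] := eqVneq (E i) 0.
  by rewrite scaler0 mul0mx norm20 expr0n mulr0 /dot adj0 mul0mx mxE.
rewrite -scalemxAl dotZl Ev; apply: ler_wpM2r; first by rewrite ler0c sqr_ge0.
have -> : (`|t i| ^+ 2)^* = `|t i| ^+ 2 by apply/CrealP; rewrite rpredX // normr_real.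
rewrite ler_pXn2r ?nnegrE ?normr_ge0 ?ler0c //.
by rewrite -(RRe_real (normr_real (t i))) lecR h.
Qed.

Lemma op_norm_diag_ge (t : I -> C) i : E i != 0 ->
  complex.Re `|t i| <= op_norm (\sum_i t i *: E i).
Proof.
move=> Ei; have [v v1 Ev] := minimal_projectionP (Emin i) Ei.
have EEv : E i *m v = v.
  by rewrite Ev -mulmxA [adj v *m v]mx11_scalar -/(dot v v) dot_norm2 v1 expr1n mulmx1.
have := op_normP (\sum_i t i *: E i) v; rewrite v1 mulr1; apply: le_trans.
rewrite mulmx_suml (bigD1 i) //= big1 ?addr0 => [|j ji].
  by rewrite -scalemxAl EEv norm2Z v1 mulr1.
by rewrite -scalemxAl -EEv mulmxA Eorth // mul0mx scaler0.
Qed.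

End DiagonalCombination.

End MinimalProjections.
(** * Isometry of diagonal maps *)

Section DiagonalAmplification.
Context {R : realType}.
Local Notation C := R[i].

Lemma op_norm_linear_bound m n (L : 'M[C]_m -> 'M[C]_n) :
  (forall c M N, L (c *: M + N) = c *: L M + L N) ->
  exists2 K : R, 0 <= K & forall M, op_norm (L M) <= K * op_norm M.
Proof.
move=> Llin; exists (\sum_i \sum_j op_norm (L (delta_mx i j))).
  by apply: sumr_ge0 => i _; apply: sumr_ge0 => j _; apply: op_norm_ge0.
have LD M N : L (M + N) = L M + L N by rewrite -[M]scale1r Llin !scale1r.
have L0 : L 0 = 0.
  by apply: (addIr (L 0)); rewrite -LD addr0 add0r.
have LZ c M : L (c *: M) = c *: L M by rewrite -[c *: M]addr0 Llin L0 addr0.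
move=> M; rewrite {1}[M]matrix_sum_delta (big_morph L LD L0).
apply: le_trans (op_norm_sum _ _ _) _; rewrite mulr_suml; apply: ler_sum => i _.
rewrite (big_morph L LD L0).
apply: le_trans (op_norm_sum _ _ _) _; rewrite mulr_suml; apply: ler_sum => j _.
rewrite LZ; apply: le_trans (op_normZ_le _ _) _; rewrite mulrC.
by apply: ler_wpM2l; [exact: op_norm_ge0|exact: op_norm_entry].
Qed.

Variables (r s r' : nat) (Y : finType) (theta : 'M[C]_(r * s) -> 'M[C]_r').
Hypothesis theta_iso : matrix_star_iso theta.
Variable q : Y -> 'M[C]_s.
Hypothesis q_proj : forall y, adj (q y) = q y /\ q y *m q y = q y.
Hypothesis q_orth : forall y y', y != y' -> q y *m q y' = 0.

Lemma thetaD M N : theta (M + N) = theta M + theta N.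
Proof. by case: theta_iso => h _ _ _; rewrite -[M]scale1r h !scale1r. Qed.

Lemma theta0 : theta 0 = 0.
Proof. by apply: (addIr (theta 0)); rewrite -thetaD addr0 add0r. Qed.

Lemma thetaZ c M : theta (c *: M) = c *: theta M.
Proof. by case: theta_iso => h _ _ _; rewrite -[c *: M]addr0 h theta0 addr0. Qed.

Lemma thetaM M N : theta (M *m N) = theta M *m theta N.
Proof. by case: theta_iso. Qed.

Lemma theta_adj M : theta (adj M) = adj (theta M).
Proof. by case: theta_iso => _ _ h _; exact: h. Qed.

Lemma theta_sum (J : Type) (l : seq J) (F : J -> 'M[C]_(r * s)) :
  theta (\sum_(j <- l) F j) = \sum_(j <- l) theta (F j).
Proof. by apply: (big_morph theta thetaD theta0). Qed.

Lemma theta_minimal E : minimal_projection E -> minimal_projection (theta E).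
Proof.
move=> [Es EE E1]; split; first by rewrite -theta_adj Es.
  by rewrite -thetaM EE.
move=> M; case: theta_iso => _ _ _ [tinv tK Kt]; have [c cE] := E1 (tinv M).
by exists c; rewrite -(Kt M) -!thetaM cE thetaZ.
Qed.

Lemma tensDl (M N : 'M[C]_r) (P : 'M[C]_s) : tensmx (M + N) P = tensmx M P + tensmx N P.
Proof. by apply/matrixP => i j; rewrite !mxE mulrDl. Qed.

Lemma tensZl c (M : 'M[C]_r) (P : 'M[C]_s) : tensmx (c *: M) P = c *: tensmx M P.
Proof. by apply/matrixP => i j; rewrite !mxE mulrA. Qed.

(** The fibre of [diagonal_map] over one point; [a y] stands for the value at the image under the
    [y]-th map. *)
Definition amplify (a : Y -> 'M[C]_r) := \sum_y theta (tensmx (a y) (q y)).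

Lemma theta_tensM a b y y' : theta (tensmx (a y) (q y)) *m theta (tensmx (b y') (q y')) =
  if y == y' then theta (tensmx (a y *m b y) (q y)) else 0.
Proof.
rewrite -thetaM tensmx_mul; case: eqP => [<-|/eqP yy'].
  by have [_ ->] := q_proj y.
by rewrite q_orth // tensmx0 theta0.
Qed.

Lemma amplifyM a b : amplify a *m amplify b = amplify (fun y => a y *m b y).
Proof.
rewrite mulmx_suml; apply: eq_bigr => y _; rewrite mulmx_sumr (bigD1 y) //= big1.
  by rewrite addr0 theta_tensM eqxx.
by move=> y' yy'; rewrite theta_tensM eq_sym (negPf yy').
Qed.

Lemma amplify_adj a : adj (amplify a) = amplify (fun y => adj (a y)).
Proof.
rewrite adj_sum; apply: eq_bigr => y _.
by rewrite -theta_adj adj_tens; have [-> _] := q_proj y.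
Qed.

Lemma amplify_sqiter k a : sqiter k (amplify a) = amplify (fun y => sqiter k (a y)).
Proof. by elim: k => //= k ->; rewrite amplifyM. Qed.

(** Each summand is linear in [a y], hence bounded by some [K y]. Since [amplify] is multiplicative
    and commutes with adjoints, the same bound holds for all powers [2^k] of [adj X *m X], and
    [pow_bound_le] discards the constants. *)
Lemma op_norm_amplify_le a t : 0 <= t -> (forall y, q y != 0 -> op_norm (a y) <= t) ->
  op_norm (amplify a) <= t.
Proof.
move=> t0 h.
have bnd y : exists2 K : R, 0 <= K &
    forall M, op_norm (theta (tensmx M (q y))) <= K * op_norm M.
  by apply: op_norm_linear_bound => c M N; rewrite tensDl tensZl thetaD thetaZ.
have [K K0 KP] : exists2 K : Y -> R, (forall y, 0 <= K y) &
    forall y M, op_norm (theta (tensmx M (q y))) <= K y * op_norm M.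
  have [K KP] := choice (fun y => (exists2P _ _).1 (bnd y)).
  by exists K => y; have [] := KP y.
rewrite -(ler_pXn2r (n := 2)) ?nnegrE ?op_norm_ge0 // -op_norm_cstar.
apply: (@pow_bound_le _ _ _ (\sum_y K y)); rewrite ?op_norm_ge0 ?exprn_ge0 ?sumr_ge0 //.
move=> k; rewrite -op_norm_sqiter; last by rewrite adjM adjK.
rewrite amplify_adj amplifyM amplify_sqiter; apply: le_trans (op_norm_sum _ _ _) _.
rewrite mulr_suml; apply: ler_sum => y _.
have [q0|qy] := eqVneq (q y) 0.
  by rewrite q0 tensmx0 theta0 op_norm0 mulr_ge0 // !exprn_ge0.
apply: le_trans (KP _ _) _; apply: ler_wpM2l => //.
rewrite op_norm_sqiter; last by rewrite adjM adjK.
by rewrite op_norm_cstar !lerXn2r ?nnegrE ?exprn_ge0 ?op_norm_ge0 // h.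
Qed.

(** Cutting by the projection [H 1%:M] leaves the [y]-th summand. The *-homomorphism [H] has a
    linear left inverse, and the constant bounding that inverse is again removed by squaring. *)
Lemma op_norm_amplify_ge a y : q y != 0 -> op_norm (a y) <= op_norm (amplify a).
Proof.
move=> qy.
pose H X := theta (tensmx X (q y)).
have Hs X : adj (H X) = H (adj X).
  by rewrite /H -theta_adj adj_tens; have [-> _] := q_proj y.
have HM X X' : H X *m H X' = H (X *m X').
  by rewrite /H -thetaM tensmx_mul; have [_ ->] := q_proj y.
have Hit k X : sqiter k (H X) = H (sqiter k X) by elim: k => //= k ->; rewrite HM.
have HE : H (a y) = amplify a *m H 1%:M.
  rewrite mulmx_suml (bigD1 y) //= big1.
    by rewrite addr0 -thetaM tensmx_mul mulmx1; have [_ ->] := q_proj y.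
  by move=> y' yy'; rewrite -thetaM tensmx_mul q_orth // tensmx0 theta0.
have H1 : op_norm (H 1%:M) <= 1.
  apply: op_norm_proj_le1; last by rewrite HM mulmx1.
  by rewrite Hs; congr H; apply/matrixP => i j; rewrite adjE !mxE conjC_nat eq_sym.
apply: (@le_trans _ _ (op_norm (H (a y)))); last first.
  rewrite HE; apply: le_trans (op_normM _ _) _.
  by rewrite ler_piMr // op_norm_ge0.
have [K K0 KP] : exists2 K : R, 0 <= K & forall X, op_norm X <= K * op_norm (H X).
  have [tinv tK Kt] : bijective theta by case: theta_iso.
  have tl c M N : tinv (c *: M + N) = c *: tinv M + tinv N.
    by apply: (can_inj tK); rewrite thetaD thetaZ !Kt.
  have [K K0 KP] := op_norm_linear_bound tl.
  have [k [l kl]] : exists k l, q y k l != 0.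
    apply: contraPP qy => h; apply/negP; rewrite negbK; apply/eqP/matrixP => i j.
    by rewrite mxE; apply/eqP; apply: contra_notT h => ?; exists i, j.
  (* Recovers the first tensor factor by reading off a nonzero entry of [q y] and dividing by it. *)
  pose slice (W : 'M[C]_(r * s)) : 'M[C]_r :=
    (q y k l)^-1 *: \matrix_(i, j) W (mxtens_index (i, k)) (mxtens_index (j, l)).
  have sl c M N : slice (c *: M + N) = c *: slice M + slice N.
    apply/matrixP => i j; rewrite !mxE; ring.
  have [K' K'0 K'P] := op_norm_linear_bound sl.
  have HK X : slice (tinv (H X)) = X.
    apply/matrixP => i j; rewrite /H tK !mxE !mxtens_indexK /=.
    by rewrite mulrCA mulVf // mulr1.
  exists (K' * K) => [|X]; first exact: mulr_ge0.
  rewrite -{1}(HK X); apply: le_trans (K'P _) _.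
  by rewrite -mulrA; apply: ler_wpM2l.
have sa n (X : 'M[C]_n) : adj (adj X *m X) = adj X *m X by rewrite adjM adjK.
rewrite -(ler_pXn2r (n := 2)) ?nnegrE ?op_norm_ge0 // -!op_norm_cstar.
apply: (@pow_bound_le _ _ _ K) => //; try exact: op_norm_ge0.
move=> k; rewrite -(op_norm_sqiter k (sa _ (a y))) -(op_norm_sqiter k (sa _ (H (a y)))).
by rewrite Hs HM Hit.
Qed.

End DiagonalAmplification.
(** * Continuity of matrix-valued functions *)

Section Continuity.
Context {R : realType}.
Local Notation C := R[i].
Variable T : topologicalType.

(* Pinning the codomain avoids slow unification between the structures on [R[i]]. *)
Definition scalar_continuous (f : T -> C) : Prop := continuous f.

Lemma mx_continuousP m n (a : T -> 'M[C]_(m, n)) :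
  continuous a <-> forall i j, scalar_continuous (fun z => a z i j).
Proof.
split=> [ca i j z A Az|h z A [P Pz PA]].
  have /ca : nbhs (a z) [set M | A (M i j)] by
    exists (fun k l => if (k == i) && (l == j) then A else setT) => [k l|M /(_ i j)];
    [case: ifP => [/andP[/eqP-> /eqP->]//|_]; exact: filterT|rewrite !eqxx].
  by [].
have : nbhs z [set z' | forall k : 'I_m * 'I_n, P k.1 k.2 (a z' k.1 k.2)].
  by apply: filter_forall => -[i j]; apply: h; apply: Pz.
by apply: filterS => z' h'; apply: PA => i j; exact: (h' (i, j)).
Qed.

Lemma continuousC_M (f g : T -> C) : scalar_continuous f -> scalar_continuous g ->
  scalar_continuous (fun z => f z * g z).
Proof. move=> cf cg z; apply: cvgM; [exact: cf|exact: cg]. Qed.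

Lemma continuousC_D (f g : T -> C) : scalar_continuous f -> scalar_continuous g ->
  scalar_continuous (fun z => f z + g z).
Proof. move=> cf cg z; apply: cvgD; [exact: cf|exact: cg]. Qed.

Lemma continuousC_norm (f : T -> C) : scalar_continuous f -> scalar_continuous (fun z => `|f z|).
Proof. move=> cf z; apply: cvg_norm; exact: cf. Qed.

Lemma continuousC_cst (c : C) : scalar_continuous (fun _ : T => c).
Proof. move=> z; exact: cvg_cst. Qed.

Lemma continuousC_conj (f : T -> C) : scalar_continuous f -> scalar_continuous (fun z => (f z)^*).
Proof.
move=> cf z; apply/cvgrPdist_lt => e e0.
have /cvgrPdist_lt/(_ e e0) := cf z; apply: filterS => z'.
by rewrite -rmorphB norm_conjC.
Qed.

(** The difference of the roots is at most their sum. The estimate serves both the continuity of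
    coefficientwise roots and [tower_sqrt_lip]. *)
Lemma dist_sqrtC_sq (x y : C) : 0 <= x -> 0 <= y -> `|sqrtC x - sqrtC y| ^+ 2 <= `|x - y|.
Proof.
wlog xy : x y / x <= y => [hw|] x0 y0.
  have [/hw|/hw] := orP (real_leVge (ger0_real x0) (ger0_real y0)); first exact.
  by rewrite (distrC (sqrtC x)) (distrC x) => ->.
have sxy : sqrtC x <= sqrtC y by rewrite ler_sqrtC.
rewrite (distrC (sqrtC x)) (distrC x) !ger0_norm ?subr_ge0 //.
rewrite -{2}(sqrtCK x) -{2}(sqrtCK y) subr_sqr expr2 ler_wpM2l ?subr_ge0 //.
by rewrite lerD2l (le_trans (_ : _ <= 0)) ?oppr_le0 ?sqrtC_ge0.
Qed.

Lemma continuousC_sqrt (f : T -> C) : scalar_continuous f -> (forall z, 0 <= f z) ->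
  scalar_continuous (fun z => sqrtC (f z)).
Proof.
move=> cf f0 z; apply/cvgrPdist_lt => e e0.
have /cvgrPdist_lt/(_ (e ^+ 2)) := cf z; rewrite exprn_gt0 // => /(_ isT).
apply: filterS => z' fz.
rewrite -(ltr_pXn2r (n := 2)) ?nnegrE ?normr_ge0 ?(ltW e0) //.
exact: le_lt_trans (dist_sqrtC_sq (f0 z) (f0 z')) fz.
Qed.

Lemma continuousC_sum (I : Type) (l : seq I) (F : I -> T -> C) :
  (forall i, scalar_continuous (F i)) -> scalar_continuous (fun z => \sum_(i <- l) F i z).
Proof.
move=> cF; elim: l => [|i l IH].
  by under eq_fun do rewrite big_nil; exact: continuousC_cst.
have -> : (fun z => \sum_(j <- i :: l) F j z) = (fun z => F i z + \sum_(j <- l) F j z :> C).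
  by apply/funext => z; rewrite big_cons.
exact (continuousC_D (cF i) IH).
Qed.

Lemma continuous_mulmx m n p (a : T -> 'M[C]_(m, n)) (b : T -> 'M[C]_(n, p)) :
  continuous a -> continuous b -> continuous (fun z => a z *m b z).
Proof.
move=> /mx_continuousP ca /mx_continuousP cb; apply/mx_continuousP => i j.
under eq_fun do rewrite mxE.
by apply: continuousC_sum => k; exact (continuousC_M (ca i k) (cb k j)).
Qed.

Lemma continuous_addmx m n (a b : T -> 'M[C]_(m, n)) :
  continuous a -> continuous b -> continuous (fun z => a z + b z).
Proof.
move=> /mx_continuousP ca /mx_continuousP cb; apply/mx_continuousP => i j.
have -> : (fun z => (a z + b z) i j) = (fun z => a z i j + b z i j :> C).
  by apply/funext => z; rewrite mxE.
exact (continuousC_D (ca i j) (cb i j)).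
Qed.

Lemma continuous_scalemx m n (f : T -> C) (a : T -> 'M[C]_(m, n)) :
  scalar_continuous f -> continuous a -> continuous (fun z => f z *: a z).
Proof.
move=> cf /mx_continuousP ca; apply/mx_continuousP => i j.
under eq_fun do rewrite mxE.
exact (continuousC_M cf (ca i j)).
Qed.

Lemma continuous_summx m n (I : Type) (l : seq I) (F : I -> T -> 'M[C]_(m, n)) :
  (forall i, continuous (F i)) -> continuous (fun z => \sum_(i <- l) F i z).
Proof.
move=> cF; apply/mx_continuousP => i j; under eq_fun do rewrite summxE.
by apply: continuousC_sum => k; move/mx_continuousP: (cF k); apply.
Qed.

Lemma continuous_adj m n (a : T -> 'M[C]_(m, n)) :
  continuous a -> continuous (fun z => adj (a z)).
Proof.
move=> /mx_continuousP ca; apply/mx_continuousP => i j.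
by under eq_fun do rewrite adjE; apply: continuousC_conj.
Qed.

Lemma continuous_tr n (a : T -> 'M[C]_n) : continuous a -> scalar_continuous (fun z => \tr (a z)).
Proof. by move=> /mx_continuousP ca; apply: continuousC_sum => i; exact: ca. Qed.

Lemma continuous_tens m n p k (a : T -> 'M[C]_(m, n)) (b : T -> 'M[C]_(p, k)) :
  continuous a -> continuous b -> continuous (fun z => tensmx (a z) (b z)).
Proof.
move=> /mx_continuousP ca /mx_continuousP cb; apply/mx_continuousP => i j.
under eq_fun do rewrite mxE.
exact (continuousC_M (ca _ _) (cb _ _)).
Qed.

Lemma continuous_cst_mx m n (M : 'M[C]_(m, n)) : continuous (fun _ : T => M).
Proof. by move=> z; apply: cvg_cst. Qed.

Lemma continuous_linear m n (L : 'M[C]_m -> 'M[C]_n) (a : T -> 'M[C]_m) :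
  (forall M N, L (M + N) = L M + L N) -> (forall c M, L (c *: M) = c *: L M) ->
  continuous a -> continuous (fun z => L (a z)).
Proof.
move=> LD LZ /mx_continuousP ca.
have L0 : L 0 = 0 by rewrite -(scale0r 0) LZ scale0r.
have LE z : L (a z) = \sum_i \sum_j a z i j *: L (delta_mx i j).
  rewrite {1}[a z]matrix_sum_delta (big_morph L LD L0); apply: eq_bigr => i _.
  by rewrite (big_morph L LD L0); apply: eq_bigr => j _; rewrite LZ.
under eq_fun do rewrite LE.
apply: continuous_summx => i; apply: continuous_summx => j.
by apply: continuous_scalemx => //; exact: continuous_cst_mx.
Qed.

Lemma op_norm_entries n (M : 'M[C]_n) : op_norm M <= \sum_i \sum_j complex.Re `|M i j|.
Proof.
rewrite {1}[M]matrix_sum_delta.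
apply: le_trans (op_norm_sum _ _ _) _; apply: ler_sum => i _.
apply: le_trans (op_norm_sum _ _ _) _; apply: ler_sum => j _.
apply: le_trans (op_normZ_le _ _) _; apply: ler_piMr.
  by rewrite -ler0c RRe_real ?normr_real.
apply: op_norm_le => [|v]; first exact: ler01.
have -> : delta_mx i j *m v = v j 0 *: delta_mx i 0.
  apply/matrixP => k l; rewrite !mxE (bigD1 j) //= big1 ?addr0 => [|t tj].
    by rewrite ord1 !mxE !eqxx !andbT mulrC.
  by rewrite mxE (negPf tj) andbF mul0r.
by rewrite norm2Z norm2_delta mulr1 mul1r norm2_entry.
Qed.

(** Guarantees that [sup_norm] dominates pointwise norms instead of taking the default value of
    [sup]. *)
Lemma op_norm_bounded n (a : T -> 'M[C]_n) : compact [set: T] -> continuous a ->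
  exists K : R, forall z, op_norm (a z) <= K.
Proof.
move=> cT /mx_continuousP ca.
have h i j : exists K : R, forall z, complex.Re `|a z i j| <= K.
  have cr : continuous (fun z => complex.Re `|a z i j|).
    move=> z; apply/cvgrPdist_lt => e e0.
    have ec : 0 < (e%:C)%C :> C by rewrite ltcR.
    have /cvgrPdist_lt/(_ _ ec) := @continuousC_norm _ (ca i j) z; apply: filterS => z'.
    rewrite -ltcR; apply: le_lt_trans; rewrite -raddfB.
    exact: normc_ge_Re.
  have /compact_bounded[M [Mr MP]] : compact ((fun z => complex.Re `|a z i j|) @` [set: T]).
    by apply: continuous_compact => //; apply: continuous_subspaceT.
  exists (M + 1) => z; apply: le_trans (ler_norm _) _.
  by apply: (MP (M + 1)); [rewrite ltrDl ltr01|exists z].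
have [K KP] := choice (fun ij : 'I_n * 'I_n => h ij.1 ij.2).
exists (\sum_i \sum_j K (i, j)) => z.
apply: le_trans (op_norm_entries _) _; apply: ler_sum => i _; apply: ler_sum => j _.
exact: (KP (i, j)).
Qed.

End Continuity.
(** * The inductive system *)

Section InductiveSystem.
Context {R : realType}.
Local Notation C := R[i].
Variables (T : nat -> topologicalType) (r s : nat -> nat).
Variable p : forall n, T n -> 'M[C]_(r n).
Arguments p : clear implicits.
Variable theta : forall n, 'M[C]_(r n * s n) -> 'M[C]_(r n.+1).
Arguments theta : clear implicits.
Variables (Y : nat -> finType) (lam : forall n, Y n -> T n.+1 -> T n).
Arguments lam : clear implicits.
Variable q : forall n, Y n -> T n.+1 -> 'M[C]_(s n).
Arguments q : clear implicits.
Variables (I0 : finType) (e0 : I0 -> T 0%N -> 'M[C]_(r 0%N)).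
Local Notation phi n := (diagonal_map (theta n) (lam n) (q n)).

Hypothesis Tcompact : forall n, compact [set: T n].
Hypothesis p_proj : forall n, projection (p n).
Hypothesis theta_iso : forall n, matrix_star_iso (theta n).
Hypothesis lam_cont : forall n y, continuous (lam n y).
Hypothesis q_proj : forall n y, projection (q n y).
Hypothesis q_orth : forall n y y', y != y' -> orthogonal_fun (q n y) (q n y').
Hypothesis q_min : forall n y z, minimal_projection (q n y z).
Hypothesis phi_unital : forall n, phi n (p n) = p n.+1.
Hypothesis phi_inj : forall n, set_inj (corner (p n)) (phi n).
Hypothesis e0_cont : forall i, continuous (e0 i).
Hypothesis e0_min : forall i z, minimal_projection (e0 i z).
Hypothesis e0_orth : forall i j z, i != j -> e0 i z *m e0 j z = 0.
Hypothesis e0_sum : forall z, \sum_i e0 i z = p 0%N z.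

Fixpoint line_index n : finType :=
  if n is n'.+1 then (Y n' * line_index n')%type else I0.

Fixpoint line n : line_index n -> T n -> 'M[C]_(r n) :=
  match n with
  | 0%N => e0
  | n'.+1 => fun yx z =>
      theta n' (tensmx (line yx.2 (lam n' yx.1 z)) (q n' yx.1 z))
  end.
Arguments line : clear implicits.

Lemma q_projE n z y : adj (q n y z) = q n y z /\ q n y z *m q n y z = q n y z.
Proof. by case: (q_proj y) => _ /(_ z) [? ?]; split. Qed.

Lemma q_orthE n z y y' : y != y' -> q n y z *m q n y' z = 0.
Proof. by move=> yy'; apply: q_orth. Qed.

Lemma p_adj n z : adj (p n z) = p n z.
Proof. by have [_ /(_ z) [_ h]] := p_proj n. Qed.

Lemma p_idem n z : p n z *m p n z = p n z.
Proof. by have [_ /(_ z) []] := p_proj n. Qed.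

Lemma p_cont n : continuous (p n).
Proof. by have [] := p_proj n. Qed.

Lemma phiE n a z :
  phi n a z = amplify (theta n) (fun y => q n y z) (fun y => a (lam n y z)).
Proof. by []. Qed.

Lemma line_min n i z : minimal_projection (line n i z).
Proof.
elim: n i z => [|n IH] i z /=; first exact: e0_min.
by apply: theta_minimal (theta_iso n) _ _; apply: minimal_tens.
Qed.

Lemma line_orth n i j z : i != j -> line n i z *m line n j z = 0.
Proof.
elim: n i j z => [|n IH] i j z; first exact: e0_orth.
case: i j => [y x] [y' x']; rewrite xpair_eqE /= => ij.
rewrite -(thetaM (theta_iso n)) tensmx_mul.
have [yy'|yy'] := eqVneq y y'; last by rewrite q_orthE // tensmx0 (theta0 (theta_iso n)).
by rewrite yy' eqxx /= in ij *; rewrite IH // tens0mx (theta0 (theta_iso n)).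
Qed.

(** Summing over the old lines rebuilds the connecting map applied to [p n]; unitality turns it into
    [p n.+1]. *)
Lemma line_sum n z : \sum_i line n i z = p n z.
Proof.
elim: n z => [|n IH] z; first exact: e0_sum.
rewrite -phi_unital phiE /amplify.
rewrite -(pair_bigA _ (fun y x => theta n (tensmx (line n x (lam n y z)) (q n y z)))) /=.
apply: eq_bigr => y _; rewrite -(theta_sum (theta_iso n)); congr (theta n _).
rewrite -IH; apply/matrixP => i j; rewrite summxE !mxE summxE mulr_suml.
by apply: eq_bigr => x _; rewrite mxE.
Qed.

Lemma continuous_lam n m k y (a : T n -> 'M[C]_(m, k)) :
  continuous a -> continuous (fun z => a (lam n y z)).
Proof. by move=> ca z; apply: continuous_comp; [exact: lam_cont|exact: ca]. Qed.

Lemma continuous_theta n (a : T n.+1 -> 'M[C]_(r n * s n)) :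
  continuous a -> continuous (fun z => theta n (a z)).
Proof.
exact (continuous_linear (thetaD (theta_iso n)) (thetaZ (theta_iso n))).
Qed.

Lemma q_cont n y : continuous (q n y).
Proof. by have [] := q_proj y. Qed.

Lemma line_cont n i : continuous (line n i).
Proof.
elim: n i => [|n IH] i; first exact: e0_cont.
exact (continuous_theta (continuous_tens (continuous_lam (IH _)) (@q_cont n _))).
Qed.

Lemma cornerP n a : corner (p n) a <->
  continuous a /\ forall z, p n z *m a z *m p n z = a z.
Proof.
split=> [[b cb <-]|[ca pa]]; last by exists a => //; apply/funext.
split=> [|z].
  exact (continuous_mulmx (continuous_mulmx (@p_cont n) cb) (@p_cont n)).
by rewrite !mulmxA p_idem -mulmxA p_idem.
Qed.

Lemma corner_cont n a : corner (p n) a -> continuous a.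
Proof. by move=> /cornerP[]. Qed.

Lemma cornerE n a z : corner (p n) a -> p n z *m a z *m p n z = a z.
Proof. by move=> /cornerP[_ ->]. Qed.

Lemma corner_l n a z : corner (p n) a -> p n z *m a z = a z.
Proof. by move=> ca; rewrite -(cornerE z ca) !mulmxA p_idem. Qed.

Lemma corner_r n a z : corner (p n) a -> a z *m p n z = a z.
Proof. by move=> ca; rewrite -(cornerE z ca) -mulmxA p_idem. Qed.

Lemma cornerD n a b : corner (p n) a -> corner (p n) b -> corner (p n) (fun z => a z + b z).
Proof.
move=> ca cb; apply/cornerP; split=> [|z].
  exact (continuous_addmx (corner_cont ca) (corner_cont cb)).
by rewrite mulmxDr mulmxDl !cornerE.
Qed.

Lemma cornerZf n (f : T n -> C) a : scalar_continuous f -> corner (p n) a ->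
  corner (p n) (fun z => f z *: a z).
Proof.
move=> cf ca; apply/cornerP; split=> [|z].
  exact (continuous_scalemx cf (corner_cont ca)).
by rewrite -scalemxAr -scalemxAl cornerE.
Qed.

Lemma cornerZ n c a : corner (p n) a -> corner (p n) (fun z => c *: a z).
Proof. exact (@cornerZf n (fun=> c) a (@continuousC_cst _ _ c)). Qed.

Lemma cornerM n a b : corner (p n) a -> corner (p n) b -> corner (p n) (fun z => a z *m b z).
Proof.
move=> ca cb; apply/cornerP; split=> [|z].
  exact (continuous_mulmx (corner_cont ca) (corner_cont cb)).
by rewrite mulmxA -mulmxA corner_l // corner_r.
Qed.

Lemma corner_adj n a : corner (p n) a -> corner (p n) (fun z => adj (a z)).
Proof.
move=> ca; apply/cornerP; split=> [|z].
  exact (continuous_adj (corner_cont ca)).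
by rewrite -{1 2}p_adj -!adjM mulmxA cornerE.
Qed.

Lemma corner0 n : corner (p n) (fun=> 0).
Proof.
apply/cornerP; split=> [|z]; last by rewrite mulmx0 mul0mx.
exact (@continuous_cst_mx _ _ _ _ 0).
Qed.

Lemma corner_sum n (J : Type) (l : seq J) (F : J -> T n -> 'M[C]_(r n)) :
  (forall j, corner (p n) (F j)) -> corner (p n) (fun z => \sum_(j <- l) F j z).
Proof.
move=> cF; elim: l => [|j l IH].
  by under eq_fun do rewrite big_nil; exact: corner0.
by under eq_fun do rewrite big_cons; exact: cornerD.
Qed.

Lemma corner_p n : corner (p n) (p n).
Proof. by apply/cornerP; split=> [|z]; [exact: p_cont|rewrite !p_idem]. Qed.

Lemma line_p n i z : line n i z *m p n z = line n i z.
Proof.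
rewrite -line_sum mulmx_sumr (bigD1 i) //= big1 ?addr0.
  by have [] := line_min i z.
by move=> j ji; rewrite line_orth // eq_sym.
Qed.

Lemma corner_line n i : corner (p n) (line n i).
Proof.
apply/cornerP; split=> [|z]; first exact: line_cont.
have ls : adj (line n i z) = line n i z by have [] := line_min i z.
by rewrite -mulmxA line_p -{1}ls -p_adj -adjM line_p.
Qed.

Lemma phiM n a b : phi n (fun z => a z *m b z) = (fun z => phi n a z *m phi n b z).
Proof.
apply/funext => z; rewrite !phiE amplifyM //; first exact: q_projE.
exact: q_orthE.
Qed.

Lemma corner_phi n a : corner (p n) a -> corner (p n.+1) (phi n a).
Proof.
move=> ca; apply/cornerP; split=> [|z].
  apply continuous_summx => y.
  exact (continuous_theta (continuous_tens (continuous_lam (corner_cont ca)) (@q_cont n y))).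
have aE : a = (fun z => p n z *m a z *m p n z) by apply/funext => z'; rewrite cornerE.
rewrite -phi_unital; apply/esym; rewrite {1}aE.
by rewrite (phiM (fun z => p n z *m a z) (p n)) phiM.
Qed.

Lemma op_norm_phi_le n a t : 0 <= t -> (forall z, op_norm (a z) <= t) ->
  forall z, op_norm (phi n a z) <= t.
Proof.
move=> t0 h z; rewrite phiE; apply: (op_norm_amplify_le (theta_iso n)) => //.
  exact: q_projE.
exact: q_orthE.
Qed.

(* Injectivity of [phi n] is tested on a multiple of [p n] supported where [a] is large. *)
Lemma op_norm_phi_ge n a t : corner (p n) a -> 0 <= t ->
  (forall z, op_norm (phi n a z) <= t) -> forall z, op_norm (a z) <= t.
Proof.
move=> ca t0 h z0; rewrite leNgt; apply/negP => /op_norm_gt[v v1 av].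
pose g z : C := dot (a z *m v) (a z *m v) - (t ^+ 2)%:C%C.
have gR z : g z = ((norm2 (a z *m v)) ^+ 2 - t ^+ 2)%:C%C by rewrite /g dot_norm2 rmorphB.
(* Twice the positive part of [g]: nonzero exactly where [a z] stretches [v] beyond [t]. *)
pose f z := g z + `|g z|.
have cg : scalar_continuous g.
  have cav := continuous_mulmx (corner_cont ca) (@continuous_cst_mx _ (T n) _ _ v).
  have cd := continuous_mulmx (continuous_adj cav) cav.
  exact (continuousC_D (proj1 (mx_continuousP _) cd 0 0) (@continuousC_cst _ _ _)).
have cf : scalar_continuous f by exact (continuousC_D cg (continuousC_norm cg)).
have cb : corner (p n) (fun z => f z *: p n z) by apply: cornerZf => //; exact: corner_p.
have /(congr1 (fun f => f z0)) /= : (fun z => f z *: p n z) = (fun=> 0).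
  apply: (@phi_inj n); rewrite ?inE //; first exact: corner0.
  apply/funext => z; apply: eq_bigr => y _.
  have [->|qy] := eqVneq (q n y z) 0; first by rewrite !tensmx0.
  suff -> : f (lam n y z) = 0 by rewrite scale0r.
  (* Points reached by [lam n y] over a nonzero [q n y z] have their norm recorded by [phi n a], so
     [f] vanishes there. *)
  have le_a : op_norm (a (lam n y z)) <= t.
    apply: le_trans (h z).
    have := op_norm_amplify_ge (theta_iso n) (@q_projE n z) (@q_orthE n z)
      (fun y => a (lam n y z)) qy.
    by [].
  have gle : g (lam n y z) <= 0.
    rewrite gR lecR subr_le0 ler_pXn2r ?nnegrE ?norm2_ge0 //.
    apply: le_trans (op_normP _ _) _; apply: le_trans le_a.
    by apply: ler_piMr => //; exact: op_norm_ge0.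
  by rewrite /f ler0_norm // subrr.
have g0 : 0 < g z0 by rewrite gR ltcR subr_gt0 ltr_pXn2r ?nnegrE ?norm2_ge0.
move=> /eqP; rewrite scaler_eq0 => /orP[/eqP f0|/eqP p0].
  have : 0 < f z0 by rewrite /f gtr0_norm // addr_gt0.
  by rewrite f0 ltxx.
by move: av; rewrite -(cornerE z0 ca) p0 mulmx0 mul0mx norm20 ltNge t0.
Qed.

(** * The limit algebra and the tower inside it *)

Variables (A : cstarAlgebraType R) (mu : forall n, (T n -> 'M[C]_(r n)) -> A).
Arguments mu : clear implicits.
Hypothesis A_lim : inductive_limit p (fun n => phi n) mu.

Lemma mu_hom n : star_hom (corner (p n)) (mu n). Proof. by case: A_lim. Qed.

Lemma muD n a b : corner (p n) a -> corner (p n) b ->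
  mu n (fun z => a z + b z) = mu n a + mu n b.
Proof. by case: (mu_hom n) => h _ _ _; apply: h. Qed.

Lemma muZ n c a : corner (p n) a -> mu n (fun z => c *: a z) = c *: mu n a.
Proof. by case: (mu_hom n) => _ h _ _; apply: h. Qed.

Lemma muM n a b : corner (p n) a -> corner (p n) b ->
  mu n (fun z => a z *m b z) = mu n a * mu n b.
Proof. by case: (mu_hom n) => _ _ h _; apply: h. Qed.

Lemma mu_adj n a : corner (p n) a -> mu n (fun z => adj (a z)) = star (mu n a).
Proof. by case: (mu_hom n) => _ _ _ h; apply: h. Qed.

Lemma mu_phi n a : corner (p n) a -> mu n.+1 (phi n a) = mu n a.
Proof. by case: A_lim => _ h _ _; apply: h. Qed.

Lemma mu0 n : mu n (fun=> 0) = 0.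
Proof.
rewrite -[RHS](scale0r (mu n (fun=> 0))) -(muZ _ (corner0 n)).
by congr (mu n); apply/funext => z; rewrite scale0r.
Qed.

Lemma mu_sum n (J : Type) (l : seq J) (F : J -> T n -> 'M[C]_(r n)) :
  (forall j, corner (p n) (F j)) ->
  mu n (fun z => \sum_(j <- l) F j z) = \sum_(j <- l) mu n (F j).
Proof.
move=> cF; elim: l => [|j l IH].
  by under eq_fun do rewrite big_nil; rewrite big_nil mu0.
by under eq_fun do rewrite big_cons; rewrite big_cons muD ?IH //; exact: corner_sum.
Qed.

Definition iter_phi n a m : T (m + n)%N -> 'M[C]_(r (m + n)%N) :=
  @iterate_maps (fun n => T n -> 'M[C]_(r n)) (fun n => phi n) n a m.

Lemma corner_iter n a m : corner (p n) a -> corner (p (m + n)%N) (@iter_phi n a m).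
Proof. by move=> ca; elim: m => //= m IH; apply: corner_phi. Qed.

Lemma op_norm_iter_le n a m t : 0 <= t -> (forall z, op_norm (a z) <= t) ->
  forall z, op_norm (@iter_phi n a m z) <= t.
Proof. by move=> t0 ha; elim: m => //= m IH; apply: op_norm_phi_le. Qed.

Lemma op_norm_iter_ge n a m t : corner (p n) a -> 0 <= t ->
  (forall z, op_norm (@iter_phi n a m z) <= t) -> forall z, op_norm (a z) <= t.
Proof.
move=> ca t0; elim: m => //= m IH h; apply: IH.
by apply: op_norm_phi_ge => //; apply: corner_iter.
Qed.

Lemma mu_lim n a : corner (p n) a ->
  forall e, 0 < e -> exists m, `|sup_norm (@iter_phi n a m) - nm (mu n a)| < e.
Proof.
move=> ca d d0; case: A_lim => _ _ /(_ _ _ ca)/cvgrPdist_lt/(_ _ d0)[N _ h] _.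
by exists N; rewrite distrC; apply: (h N) => /=.
Qed.

Lemma nm_mu_le n a t : corner (p n) a -> 0 <= t -> (forall z, op_norm (a z) <= t) ->
  nm (mu n a) <= t.
Proof.
move=> ca t0 h; rewrite -subr_le0; apply: small_eq0 => d d0.
have [m] := mu_lim ca d0.
have : sup_norm (@iter_phi n a m) <= t.
  have [[z0 _]|hT] := pselect (exists z : T (m + n)%N, True).
    apply: ge_sup; first by exists (op_norm (@iter_phi n a m z0)), z0.
    by move=> x [z _ <-]; exact: (op_norm_iter_le t0 h z).
  (* Over an empty space [sup_norm] is 0 by default. *)
  rewrite /sup_norm (_ : [set _ | _ in _] = set0) ?sup0 //.
  by apply/seteqP; split => // x [z _ _]; apply: hT; exists z.
by rewrite ltr_distl; lra.
Qed.

(** Injectivity of the connecting maps forbids loss of norm along the iterates; with [nm_mu_le] this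
    makes [mu n] isometric. *)
Lemma nm_mu_ge n a z : corner (p n) a -> op_norm (a z) <= nm (mu n a).
Proof.
move=> ca; rewrite leNgt; apply/negP => lt_a.
have d0 : 0 < op_norm (a z) - nm (mu n a) by rewrite subr_gt0.
have [m hS] := mu_lim ca d0; pose b := @iter_phi n a m.
have [K KP] := op_norm_bounded (@Tcompact _) (corner_cont (corner_iter m ca)).
have le_S z' : op_norm (b z') <= sup_norm b.
  by apply: ub_le_sup; [exists K => _ [z'' _ <-]|exists z'].
have S0 : 0 <= sup_norm b.
  have [[z' _]|h] := pselect (exists z' : T (m + n)%N, True).
    by apply: le_trans (le_S z'); apply: op_norm_ge0.
  rewrite /sup_norm (_ : [set _ | _ in _] = set0) ?sup0 //.
  by apply/seteqP; split => // x [z' _ _]; apply: h; exists z'.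
have := op_norm_iter_ge ca S0 le_S z.
by move: hS; rewrite ltr_distl -/b; lra.
Qed.

Lemma mu_inj n a b : corner (p n) a -> corner (p n) b -> mu n a = mu n b -> a =1 b.
Proof.
move=> ca cb ab z; apply/eqP; rewrite -subr_eq0; apply/eqP/op_norm_eq0/eqP.
rewrite eq_le op_norm_ge0 andbT.
have cN : corner (p n) (fun z => (-1) *: b z) by exact (cornerZ (-1) cb).
have /= := nm_mu_ge z (cornerD ca cN).
by rewrite muD // muZ // ab !scaleN1r subrr nm0.
Qed.

Definition tower n : set A := mu n @` corner (p n).
Definition tower_line n (i : line_index n) : A := mu n (line n i).
Arguments tower_line : clear implicits.

Definition diag n (t : line_index n -> T n -> C) z := \sum_i t i z *: line n i z.

Lemma corner_diag n t : (forall i, scalar_continuous (t i)) -> corner (p n) (@diag n t).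
Proof.
by move=> ct; apply: corner_sum => i; exact (cornerZf (ct i) (@corner_line n i)).
Qed.

Lemma line_diag n t i z : line n i z *m @diag n t z = t i z *: line n i z.
Proof.
rewrite mulmx_sumr (bigD1 i) //= big1 ?addr0 => [|j ji].
  by rewrite -scalemxAr; have [_ -> _] := line_min i z.
by rewrite -scalemxAr line_orth 1?eq_sym // scaler0.
Qed.

Lemma diagM n t t' z : @diag n t z *m @diag n t' z = diag (fun i z => t i z * t' i z) z.
Proof.
rewrite mulmx_suml; apply: eq_bigr => i _.
by rewrite -scalemxAl line_diag scalerA.
Qed.

Lemma diag_adj n t z : adj (@diag n t z) = diag (fun i z => (t i z)^*) z.
Proof.
by rewrite adj_sum; apply: eq_bigr => i _; rewrite adjZ; have [-> _ _] := line_min i z.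
Qed.

Lemma nm_diag_le n t K : (forall i, scalar_continuous (t i)) -> 0 <= K ->
  (forall i z, line n i z != 0 -> complex.Re `|t i z| <= K) -> nm (mu n (diag t)) <= K.
Proof.
move=> ct K0 h; apply: nm_mu_le => // [|z]; first exact: corner_diag.
apply: op_norm_diag_le => // [i|i j|i]; [exact: line_min|exact: line_orth|exact: h].
Qed.

Lemma nm_diag_ge n t i z : (forall i, scalar_continuous (t i)) -> line n i z != 0 ->
  complex.Re `|t i z| <= nm (mu n (diag t)).
Proof.
move=> ct li; apply: le_trans (nm_mu_ge z (corner_diag ct)).
apply: (op_norm_diag_ge (E := fun i => line n i z) _ _ (fun i => t i z)) => //.
  by move=> j; exact: line_min.
by move=> j j'; exact: line_orth.
Qed.

Definition line_coef n (a : T n -> 'M[C]_(r n)) i z : C := \tr (line n i z *m a z).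

Lemma line_coef_cont n a i : corner (p n) a -> scalar_continuous (line_coef a i).
Proof.
move=> ca; exact (continuous_tr (continuous_mulmx (@line_cont n i) (corner_cont ca))).
Qed.

Lemma corner_diag_coef n a : corner (p n) a -> corner (p n) (diag (line_coef a)).
Proof. by move=> ca; apply: corner_diag => i; exact (@line_coef_cont n a i ca). Qed.

Lemma line_compress n a i z : line n i z *m a z *m line n i z = line_coef a i z *: line n i z.
Proof. by rewrite minimal_tr //; apply: line_min. Qed.

(** The factor [line n i z] cannot be dropped: where the line vanishes the coefficient is 0,
    whatever [t i z] is. *)
Lemma line_diag_coef n t i z :
  line_coef (@diag n t) i z *: line n i z = t i z *: line n i z.
Proof.
rewrite -line_compress line_diag -scalemxAl.
by have [_ -> _] := line_min i z.
Qed.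

Lemma compressionE n a : corner (p n) a ->
  compression tower_line n (mu n a) = mu n (diag (line_coef a)).
Proof.
move=> ca.
have cF i := cornerZf (@line_coef_cont n a i ca) (@corner_line n i).
transitivity (\sum_i mu n (fun z => line_coef a i z *: line n i z)); last first.
  exact: (esym (mu_sum _ cF)).
apply: eq_bigr => i _; rewrite /tower_line -muM //; last exact: corner_line.
rewrite -muM; [|by apply: cornerM => //; exact: corner_line|exact: corner_line].
by congr (mu n); apply/funext => z; rewrite line_compress.
Qed.

Lemma towerP n x : tower n x -> exists2 a, corner (p n) a & x = mu n a.
Proof. by move=> [a ca <-]; exists a. Qed.

Lemma towerM n x y : tower n x -> tower n y -> tower n (x * y).
Proof.
move=> /towerP[a ca ->] /towerP[b cb ->].
by exists (fun z => a z *m b z); [exact: cornerM|rewrite muM].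
Qed.

Lemma tower_star n x : tower n x -> tower n (star x).
Proof.
move=> /towerP[a ca ->].
by exists (fun z => adj (a z)); [exact: corner_adj|rewrite mu_adj].
Qed.

Lemma towerS n x : tower n x -> tower n.+1 x.
Proof.
by move=> /towerP[a ca ->]; exists (phi n a); [exact: corner_phi|rewrite mu_phi].
Qed.

Lemma tower_dense x : approx [set y | exists n, tower n y] x.
Proof.
case: A_lim => _ _ _ /dense_approx/(_ x) h d /h[y [n _ ty] xy].
by exists y => //; exists n.
Qed.

Lemma tower_tower_line n i : tower n (tower_line n i).
Proof. by exists (line n i) => //; exact: corner_line. Qed.

Lemma tower_line_star n i : star (tower_line n i) = tower_line n i.
Proof.
rewrite /tower_line -mu_adj; last exact: corner_line.
by congr (mu n); apply/funext => z; have [-> _ _] := line_min i z.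
Qed.

Lemma tower_lineM n i j :
  tower_line n i * tower_line n j = if i == j then tower_line n i else 0.
Proof.
rewrite /tower_line -muM; [|exact: corner_line..].
case: eqP => [<-|/eqP ij].
  by congr (mu n); apply/funext => z; have [_ -> _] := line_min i z.
by rewrite -(mu0 n); congr (mu n); apply/funext => z; rewrite line_orth.
Qed.

(** The unit of [A] is not prescribed by the inductive limit. All [mu n (p n)] coincide and act as a
    unit on the dense tower, in particular on a sequence tending to 1. *)
Lemma mu_p n : mu n (p n) = 1.
Proof.
have muS m : mu m (p m) = mu n (p n).
  have mu0p k : mu k (p k) = mu 0%N (p 0%N).
    by elim: k => // k <-; rewrite -phi_unital mu_phi //; exact: corner_p.
  by rewrite !mu0p.
have [u u1 Tu] := approx_seq (tower_dense 1).
have h := tendsMl (mu n (p n)) u1; rewrite mulr1 in h.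
apply: tends_unique h _; apply: (tends_eq (N := 0%N)) u1 => k _.
have [m /towerP[a ca ->]] := Tu k; rewrite -(muS m) -muM //; last exact: corner_p.
by congr (mu m); apply/funext => z; rewrite corner_l.
Qed.

Lemma tower_line_sum n : \sum_i tower_line n i = 1.
Proof.
rewrite -(mu_p n) -(mu_sum _ (@corner_line n)).
by congr (mu n); apply/funext => z; rewrite line_sum.
Qed.

Local Notation Q := (compression tower_line).

(** Rank at most one enters here: each corner consists of scalar functions times the line. *)
Lemma tower_comm n i x y : tower n x -> tower n y ->
  (tower_line n i * x * tower_line n i) * (tower_line n i * y * tower_line n i) =
  (tower_line n i * y * tower_line n i) * (tower_line n i * x * tower_line n i).
Proof.
move=> /towerP[a ca ->] /towerP[b cb ->].
have ci := @corner_line n i.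
have cc c : corner (p n) c -> corner (p n) (fun z => line n i z *m c z *m line n i z).
  by move=> ?; apply: cornerM => //; apply: cornerM.
have E c : corner (p n) c -> tower_line n i * mu n c * tower_line n i =
    mu n (fun z => line n i z *m c z *m line n i z).
  by move=> ?; rewrite /tower_line -!muM //; apply: cornerM.
rewrite !E // -!muM; [|exact: cc..].
congr (mu n); apply/funext => z; rewrite !line_compress.
by rewrite -!scalemxAl -!scalemxAr !scalerA mulrC.
Qed.

Lemma phi_line_coef n a z (i : line_index n.+1) :
  line n.+1 i z *m phi n a z *m line n.+1 i z =
  theta n (tensmx (line n i.2 (lam n i.1 z) *m a (lam n i.1 z) *m line n i.2 (lam n i.1 z))
            (q n i.1 z)).
Proof.
case: i => y x /=; rewrite /diagonal_map mulmx_sumr mulmx_suml (bigD1 y) //= big1 ?addr0.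
  rewrite -!(thetaM (theta_iso n)) !tensmx_mul.
  by have [_ qq] := q_projE z y; rewrite !qq.
move=> y' yy'; rewrite -!(thetaM (theta_iso n)) !tensmx_mul.
by rewrite q_orthE 1?eq_sym // mul0mx tensmx0 (theta0 (theta_iso n)).
Qed.

(** Orthogonality of the [q n y] lets a line over [y] see only the [y]-th summand, so compressing
    commutes with the connecting map. *)
Lemma phi_diag n a z : phi n (diag (line_coef a)) z = diag (line_coef (phi n a)) z.
Proof.
rewrite /diag.
transitivity (\sum_(i : line_index n.+1) line n.+1 i z *m phi n a z *m line n.+1 i z).
  under eq_bigr => i _ do rewrite phi_line_coef.
  rewrite -(pair_bigA _ (fun y x => theta n (tensmx
    (line n x (lam n y z) *m a (lam n y z) *m line n x (lam n y z)) (q n y z)))) /=.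
  apply: eq_bigr => y _; rewrite -(theta_sum (theta_iso n)); congr (theta n _).
  apply/matrixP => i j; rewrite !mxE !summxE mulr_suml; apply: eq_bigr => x _.
  by rewrite line_compress [RHS]mxE.
by apply: eq_bigr => i _; rewrite line_compress.
Qed.

Lemma tower_compressionS n x : tower n x -> Q n.+1 x = Q n x.
Proof.
move=> /towerP[a ca ->]; rewrite -{1}(mu_phi ca) !compressionE //; last exact: corner_phi.
rewrite -(mu_phi (corner_diag_coef ca)).
by congr (mu n.+1); apply/funext => z; rewrite phi_diag.
Qed.

Lemma mu_block n a i j : corner (p n) a ->
  tower_line n i * mu n a * tower_line n j = mu n (fun z => line n i z *m a z *m line n j z).
Proof.
move=> ca; have ci := @corner_line n i; have cj := @corner_line n j.
by rewrite /tower_line -!muM //; apply: cornerM.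
Qed.

(** The block between [(y, x)] and [(y', x')] is 0 for [y != y'] and comes from the old block
    [(x, x')] otherwise. A nonzero block thus fixes [y], and the old condition fixes the rest. *)
Lemma tower_monomialS n w : tower n w -> monomial tower_line n w -> monomial tower_line n.+1 w.
Proof.
move=> /towerP[a ca ->] [row col].
have key (i j : line_index n.+1) :
    tower_line n.+1 i * mu n a * tower_line n.+1 j != 0 ->
    i.1 = j.1 /\ tower_line n i.2 * mu n a * tower_line n j.2 != 0.
  rewrite -{1}(mu_phi ca) mu_block; last exact: corner_phi.
  rewrite mu_block // => nz.
  have bE z : line n.+1 i z *m phi n a z *m line n.+1 j z =
      if i.1 == j.1 then theta n (tensmx (line n i.2 (lam n i.1 z) *m a (lam n i.1 z)
         *m line n j.2 (lam n i.1 z)) (q n i.1 z)) else 0.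
    case: i j {nz} => y x [y' x'] /=.
    rewrite /diagonal_map mulmx_sumr mulmx_suml (bigD1 y) //= big1 ?addr0; last first.
      move=> y1 yy1; rewrite -!(thetaM (theta_iso n)) !tensmx_mul.
      by rewrite q_orthE 1?eq_sym // mul0mx tensmx0 (theta0 (theta_iso n)).
    rewrite -!(thetaM (theta_iso n)) !tensmx_mul; have [_ qq] := q_projE z y.
    case: eqP => [<-|/eqP yy']; first by rewrite !qq.
    by rewrite qq q_orthE // tensmx0 (theta0 (theta_iso n)).
  have ij : i.1 = j.1.
    apply/eqP; apply: contraNT nz => ij; rewrite -(mu0 n.+1); apply/eqP.
    by congr (mu n.+1); apply/funext => z; rewrite bE (negPf ij).
  split=> //; apply: contraNN nz => /eqP w0; rewrite -(mu0 n.+1); apply/eqP.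
  congr (mu n.+1); apply/funext => z; rewrite bE ij eqxx.
  have cw : corner (p n) (fun z => line n i.2 z *m a z *m line n j.2 z).
    by apply: cornerM; [apply: cornerM => //|]; exact: corner_line.
  have := mu_inj cw (corner0 n); rewrite w0 mu0 => /(_ erefl) h.
  by rewrite -ij h tens0mx (theta0 (theta_iso n)).
split=> [i j j' /key[ij /row h] /key[ij' /h jj]|i i' j /key[ij /col h] /key[ij' /h jj]].
  by rewrite (surjective_pairing j) (surjective_pairing j') -ij -ij' jj.
by rewrite (surjective_pairing i) (surjective_pairing i') ij ij' jj.
Qed.

(** Diagonal coefficients become inner products, reducing norm estimates on a level to Hilbert space
    at one point. *)
Lemma line_unit_vector n i z : line n i z != 0 -> exists v : 'cV[C]_(r n),
  [/\ norm2 v = 1, line n i z *m v = v &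
      forall a b : T n -> 'M[C]_(r n),
        line_coef (fun z => adj (a z) *m b z) i z = dot (a z *m v) (b z *m v)].
Proof.
move=> li; have [v v1 lE] := minimal_projectionP (line_min i z) li.
exists v; split=> // [|a b].
  by rewrite lE -mulmxA [adj v *m v]mx11_scalar -/(dot v v) dot_norm2 v1 expr1n mulmx1.
by rewrite /line_coef lE tr_vv -mulmxA dot_adj adjK.
Qed.

Lemma line_coef_ge0 n (a : T n -> 'M[C]_(r n)) i z :
  0 <= line_coef (fun z => adj (a z) *m a z) i z.
Proof.
have [l0|/line_unit_vector[v [_ _ ->]]] := eqVneq (line n i z) 0.
  by rewrite /line_coef l0 mul0mx mxtrace0.
by rewrite dot_norm2 ler0c exprn_ge0 ?norm2_ge0.
Qed.

Lemma compression_star n a b : corner (p n) a -> corner (p n) b ->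
  Q n (star (mu n a) * mu n b) = mu n (diag (line_coef (fun z => adj (a z) *m b z))).
Proof.
move=> ca cb; rewrite -mu_adj // -muM //; last exact: corner_adj.
by rewrite compressionE //; apply: cornerM => //; exact: corner_adj.
Qed.

Lemma mu_diagM n t t' : (forall i, scalar_continuous (t i)) ->
  (forall i, scalar_continuous (t' i)) ->
  mu n (diag t) * mu n (diag t') = mu n (diag (fun i z => t i z * t' i z)).
Proof.
move=> ct ct'; rewrite -muM; [|exact: corner_diag..].
by congr (mu n); apply/funext => z; rewrite diagM.
Qed.

Lemma mu_diagB n t t' : (forall i, scalar_continuous (t i)) ->
  (forall i, scalar_continuous (t' i)) ->
  mu n (diag t) - mu n (diag t') = mu n (diag (fun i z => t i z - t' i z)).
Proof.
move=> ct ct'; rewrite -scaleN1r -muZ; last exact: corner_diag.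
rewrite -muD; [|exact: corner_diag|by apply: cornerZ; exact: corner_diag].
congr (mu n); apply/funext => z; rewrite scaleN1r -sumrB.
by apply: eq_bigr => i _; rewrite scalerBl.
Qed.

Lemma star_coef_cont n a b i : corner (p n) a -> corner (p n) b ->
  scalar_continuous (line_coef (fun z => adj (a z) *m b z) i).
Proof.
move=> ca cb.
exact (@line_coef_cont n (fun z => adj (a z) *m b z) i (cornerM (corner_adj ca) cb)).
Qed.

Lemma continuousC_sub n (f g : T n -> C) : scalar_continuous f -> scalar_continuous g ->
  scalar_continuous (fun z => f z - g z).
Proof.
move=> cf cg; have := continuousC_D cf (continuousC_M (@continuousC_cst _ (T n) (-1)) cg).
by under eq_fun do rewrite mulN1r.
Qed.

Lemma tower_sqrt n x : tower n x -> exists2 y, tower n y &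
  Q n (star x * x) = Q n (star y * y) * Q n (star y * y).
Proof.
move=> /towerP[a ca ->].
pose t := line_coef (fun z => adj (a z) *m a z).
have ct i : scalar_continuous (t i) by exact (@star_coef_cont _ _ _ i ca ca).
have t0 i z : 0 <= t i z by exact: line_coef_ge0.
have cu i := continuousC_sqrt (ct i) (t0 i).
have u0 i z : 0 <= sqrtC (t i z) by rewrite sqrtC_ge0.
have cw i := continuousC_sqrt (cu i) (u0 i).
(* A fourth root: squaring it once in [star y * y] must give the square root of the coefficient. *)
pose w i z := sqrtC (sqrtC (t i z)).
have cb : corner (p n) (diag w) by exact: corner_diag.
exists (mu n (diag w)); first by exists (diag w).
rewrite !compression_star //.
have -> : diag (line_coef (fun z => adj (diag w z) *m diag w z)) =
    diag (fun i z => sqrtC (t i z)).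
  apply/funext => z; apply: eq_bigr => i _.
  have -> : line_coef (fun z => adj (diag w z) *m diag w z) i z =
            line_coef (diag (fun i z => sqrtC (t i z))) i z.
    congr (\tr (_ *m _)); rewrite diag_adj diagM; apply: eq_bigr => j _.
    have -> : (w j z)^* = w j z by apply/CrealP; rewrite ger0_real // /w sqrtC_ge0.
    by rewrite -expr2 sqrtCK.
  exact: line_diag_coef.
rewrite mu_diagM //; congr (mu n); apply/funext => z; apply: eq_bigr => i _.
by rewrite -expr2 sqrtCK.
Qed.

Lemma sqr_Re_norm_le (x y : C) : `|x| ^+ 2 <= `|y| ->
  complex.Re `|x| ^+ 2 <= complex.Re `|y|.
Proof.
rewrite -lecR (RRe_real (normr_real y)).
by have -> : (complex.Re `|x| ^+ 2)%:C%C = `|x| ^+ 2 :> C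
  by rewrite -{2}(RRe_real (normr_real x)) rmorphXn.
Qed.

Lemma Re_norm_ge0 (x : C) : 0 <= complex.Re `|x|.
Proof. by rewrite -ler0c RRe_real ?normr_real. Qed.

(** Coefficientwise this is [dist_sqrtC_sq] at the squares of two nonnegative coefficients; norms of
    diagonal elements are suprema of coefficients at nonzero lines. *)
Lemma tower_sqrt_lip n x y : tower n x -> tower n y ->
  nm (Q n (star x * x) - Q n (star y * y)) ^+ 2 <=
  nm (Q n (star x * x) * Q n (star x * x) - Q n (star y * y) * Q n (star y * y)).
Proof.
move=> /towerP[a ca ->] /towerP[b cb ->]; rewrite !compression_star //.
set t := line_coef _; set t' := line_coef _.
have ct i : scalar_continuous (t i) by exact (@star_coef_cont _ _ _ i ca ca).
have ct' i : scalar_continuous (t' i) by exact (@star_coef_cont _ _ _ i cb cb).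
have cm i := continuousC_M (ct i) (ct i).
have cm' i := continuousC_M (ct' i) (ct' i).
rewrite mu_diagB // !mu_diagM // mu_diagB //.
set X := nm (mu n (diag (fun i z => t i z * t i z - t' i z * t' i z))).
have X0 : 0 <= X by exact: nm_ge0.
rewrite -(sqr_sqrtr X0) ler_pXn2r ?nnegrE ?nm_ge0 ?sqrtr_ge0 //.
apply: nm_diag_le => [i||i z li]; [exact (continuousC_sub (ct i) (ct' i))|exact: sqrtr_ge0|].
rewrite -(ler_pXn2r (n := 2)) ?nnegrE ?Re_norm_ge0 ?sqrtr_ge0 // (sqr_sqrtr X0).
apply: le_trans (nm_diag_ge (fun i => continuousC_sub (cm i) (cm' i)) li).
apply: sqr_Re_norm_le.
have tt := line_coef_ge0 a i z; have tt' := line_coef_ge0 b i z.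
have := @dist_sqrtC_sq _ (t i z ^+ 2) (t' i z ^+ 2).
rewrite (sqrCK tt) (sqrCK tt') => h; rewrite -!expr2.
by apply: h; apply: exprn_ge0.
Qed.

Lemma tower_CS n x y : tower n x -> tower n y ->
  nm (Q n (star x * y)) ^+ 2 <= nm (Q n (star x * x)) * nm (Q n (star y * y)).
Proof.
move=> /towerP[a ca ->] /towerP[b cb ->].
rewrite (compression_star ca cb) (compression_star ca ca) (compression_star cb cb).
pose X := nm (mu n (diag (line_coef (fun z => adj (a z) *m a z)))).
pose X' := nm (mu n (diag (line_coef (fun z => adj (b z) *m b z)))).
have X0 : 0 <= X * X' by apply: mulr_ge0; exact: nm_ge0.
suff h : nm (mu n (diag (line_coef (fun z => adj (a z) *m b z)))) <= Num.sqrt (X * X').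
  apply: (@le_trans _ _ (Num.sqrt (X * X') ^+ 2)); last by rewrite (sqr_sqrtr X0).
  by apply: lerXn2r h; rewrite nnegrE ?nm_ge0 ?sqrtr_ge0.
apply: nm_diag_le => [i||i z li]; [exact (@star_coef_cont _ _ _ i ca cb)|exact: sqrtr_ge0|].
have [v [v1 lv coef]] := line_unit_vector li.
have key c : corner (p n) c ->
    norm2 (c z *m v) ^+ 2 <= nm (mu n (diag (line_coef (fun z => adj (c z) *m c z)))).
  move=> cc; apply: le_trans (nm_diag_ge (fun i => @star_coef_cont n c c i cc cc) li).
  rewrite coef dot_norm2 ger0_norm ?ler0c ?exprn_ge0 ?norm2_ge0 //.
rewrite -(ler_pXn2r (n := 2)) ?nnegrE ?Re_norm_ge0 ?sqrtr_ge0 // (sqr_sqrtr X0).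
apply: (@le_trans _ _ ((norm2 (a z *m v) * norm2 (b z *m v)) ^+ 2)).
  rewrite ler_pXn2r ?nnegrE ?Re_norm_ge0 ?mulr_ge0 ?norm2_ge0 //.
  by rewrite -lecR RRe_real ?normr_real // coef dot_CS.
by rewrite exprMn; apply: ler_pM; rewrite ?exprn_ge0 ?norm2_ge0 //; exact: key.
Qed.

Lemma tower_norm n x (t : R) : tower n x -> 0 <= t -> t < nm x ->
  exists2 u, tower n u /\ nm u <= 1 & t ^+ 2 <= nm (Q n (star (x * u) * (x * u))).
Proof.
move=> /towerP[a ca ->] t0 ta.
have [z0 az] : exists z, t < op_norm (a z).
  apply: contrapT => h; move: ta; apply/negP; rewrite -leNgt.
  by apply: nm_mu_le => // z; rewrite leNgt; apply/negP => ?; apply: h; exists z.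
have [xi xi1 axi] := op_norm_gt az.
have [i li] : exists i, line n i z0 != 0.
  apply: contrapT => h.
  have p0 : p n z0 = 0.
    rewrite -line_sum big1 // => i _; apply/eqP; apply: contra_notT h => ?.
    by exists i.
  by move: az; rewrite -(cornerE z0 ca) p0 mulmx0 op_norm0 ltNge t0.
have [v [v1 lv coef]] := line_unit_vector li.
(* At [z0] the rank-one matrix in the middle sends the unit vector [v] of the line to [xi], where
   [a z0] nearly attains its norm; the outer factors put [u] into the corner. *)
pose u z := p n z *m (xi *m adj v) *m line n i z.
have cu : corner (p n) u.
  apply/cornerP; split=> [|z].
    have cpx := continuous_mulmx (@p_cont n) (@continuous_cst_mx _ _ _ _ (xi *m adj v)).
    exact (continuous_mulmx cpx (@line_cont n i)).
  by rewrite /u !mulmxA p_idem -!mulmxA line_p.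
have u1 z : op_norm (u z) <= 1.
  have [ls ll _] := line_min i z.
  have h1 := op_norm_proj_le1 (p_adj z) (p_idem z).
  have h2 := op_norm_proj_le1 ls ll.
  have h3 : op_norm (xi *m adj v) <= 1.
    apply: op_norm_le => // w; rewrite -mulmxA [adj v *m w]mx11_scalar -/(dot v w).
    rewrite mul_mx_scalar norm2Z mul1r.
    have := dot_CS v w; rewrite -(RRe_real (normr_real (dot v w))) lecR v1 mul1r.
    by apply: le_trans; apply: (ler_piMr (Re_norm_ge0 (dot v w)) xi1).
  have le1M (M N : 'M[C]_(r n)) : op_norm M <= 1 -> op_norm N <= 1 -> op_norm (M *m N) <= 1.
    move=> M1 N1; apply: le_trans (op_normM M N) _.
    exact: (mulr_ile1 (op_norm_ge0 M) (op_norm_ge0 N) M1 N1).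
  exact: le1M (le1M _ _ h1 h3) h2.
exists (mu n u).
  by split; [exists u|exact: (nm_mu_le cu ler01 u1)].
have cau : corner (p n) (fun z => a z *m u z) by exact: cornerM.
rewrite -muM // compression_star //.
apply: le_trans (nm_diag_ge (fun i => @star_coef_cont n _ _ i cau cau) li).
have auv : a z0 *m u z0 *m v = a z0 *m xi.
  rewrite /u -!mulmxA lv [adj v *m v]mx11_scalar -/(dot v v) dot_norm2 v1 expr1n mulmx1.
  by rewrite mulmxA corner_r.
rewrite coef auv dot_norm2 ger0_norm ?ler0c ?exprn_ge0 ?norm2_ge0 //=.
by rewrite ler_pXn2r ?nnegrE ?norm2_ge0 // ltW.
Qed.

Theorem limit_cstar_diagonal : cstar_diagonal (diagonal tower_line).
Proof.
apply: (@diagonal_cstar_diagonal _ _ tower).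
- exact: towerM.
- exact: tower_star.
- exact: towerS.
- exact: tower_dense.
- exact: tower_tower_line.
- exact: tower_line_star.
- exact: tower_lineM.
- exact: tower_line_sum.
- exact: tower_comm.
- exact: tower_compressionS.
- exact: tower_monomialS.
- exact: tower_sqrt.
- exact: tower_sqrt_lip.
- exact: tower_CS.
- exact: tower_norm.
Qed.

End InductiveSystem.

(** * From bundles on components to families on the whole space *)

Lemma line_bundle_minimal (R : realType) (T : topologicalType) n (e : T -> 'M[R[i]]_n) z :
  line_bundle e -> minimal_projection (e z).
Proof.
move=> [[_ /(_ z)[ee es]] /(_ z) re].
by apply: minimal_of_rank1 => //; rewrite re.
Qed.

Lemma merged_lines (R : realType) k (Z : 'I_k -> topologicalType) n
    (p : {i & Z i} -> 'M[R[i]]_n) :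
  (forall i, sum_of_line_bundles (restr p i)) ->
  exists (m : nat) (e : 'I_m -> {i & Z i} -> 'M[R[i]]_n),
    [/\ forall l, continuous (e l),
        forall l z, minimal_projection (e l z),
        forall l l' z, l != l' -> e l z *m e l' z = 0
      & forall z, \sum_l e l z = p z].
Proof.
move=> h.
pose m i := projT1 (cid (h i)).
pose e i := projT1 (cid (projT2 (cid (h i)))).
have eP i : [/\ forall l : 'I_(m i), line_bundle (e i l),
    forall l l', l != l' -> orthogonal_fun (e i l) (e i l')
    & forall z, restr p i z = \sum_l e i l z] := projT2 (cid (projT2 (cid (h i)))).
pose G i t z := oapp (fun l : 'I_(m i) => e i l z) 0 (insub t).
(* Lines of different components share an index; a component with fewer lines is padded by 0. *)
exists (\max_i m i)%N, (fun l x => G (projT1 x) l (projT2 x)); split.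
- move=> l; apply: (@sigT_continuous _ _ _ (fun i z => G i l z)) => i.
  have [le _ _] := eP i; rewrite /G; case: insub => [l'|] /=.
    by have [[]] := le l'.
  exact (@continuous_cst_mx _ _ _ _ 0).
- move=> l [i z] /=; have [le _ _] := eP i; rewrite /G; case: insub => [l'|] /=.
    exact: line_bundle_minimal.
  exact: minimal0.
- move=> l l' [i z] ll' /=; have [_ oe _] := eP i; rewrite /G.
  case: insubP => [t _ tl|_] /=; last by rewrite mul0mx.
  case: insubP => [t' _ tl'|_] /=; last by rewrite mulmx0.
  by apply: oe; apply: contraNneq ll' => tt'; apply/eqP/val_inj; rewrite /= -tl -tl' tt'.
- move=> [i z] /=; have [_ _ se] := eP i; rewrite -[RHS]/(restr p i z) se.
  have -> : \sum_(l < m i) e i l z = \sum_(l < m i) G i l z.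
    by apply: eq_bigr => l _; rewrite /G valK.
  rewrite [RHS](big_ord_widen (\max_j m j)%N (fun t => G i t z)); last exact: (leq_bigmax i).
  rewrite [RHS]big_mkcond; apply: eq_bigr => l _; case: ifP => // li.
  by rewrite /G insubF.
Qed.

Theorem theorem4 (R : realType)
  (* Z_n is the disjoint union of the spaces Z n i, i < k n *)
  (k : nat -> nat) (Z : forall n, 'I_(k n) -> topologicalType)
  (Zcompact : forall n i, compact [set: Z n i])
  (Zconnected : forall n i, connected [set: Z n i])
  (Zhausdorff : forall n i, hausdorff_space (Z n i))
  (* A_n = corner (p n) *)
  (r : nat -> nat) (p : forall n, {i & Z n i} -> 'M[R[i]]_(r n))
  (p_proj : forall n, projection (p n))
  (p_line : forall n i, sum_of_line_bundles (restr (p n) i))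
  (s : nat -> nat) (rs : forall n, (r n * s n = r n.+1)%N)
  (* the fixed isomorphisms between M_(r n) (x) M_(s n) and M_(r n.+1) *)
  (theta : forall n, 'M[R[i]]_(r n * s n) -> 'M[R[i]]_(r n.+1))
  (theta_iso : forall n, matrix_star_iso (theta n))
  (Y : nat -> finType)
  (lam : forall n, Y n -> {i & Z n.+1 i} -> {i & Z n i})
  (lam_cont : forall n y, continuous (lam n y))
  (q : forall n, Y n -> {i & Z n.+1 i} -> 'M[R[i]]_(s n))
  (q_proj : forall n y, projection (q n y))
  (q_orth : forall n y y', y != y' -> orthogonal_fun (q n y) (q n y'))
  (phi := fun n => diagonal_map (theta n) (@lam n) (@q n))
  (phi_unital : forall n, phi n (p n) = p n.+1)
  (phi_inj : forall n, set_inj (corner (p n)) (phi n))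
  (q_line : forall n (y : Y n), exists j : 'I_(k n.+1),
     line_bundle (restr (q n y) j) /\
     forall j', j' != j -> forall z, restr (q n y) j' z = 0)
  (A : cstarAlgebraType R)
  (mu : forall n, ({i & Z n i} -> 'M[R[i]]_(r n)) -> A)
  (A_lim : inductive_limit p phi mu) :
  exists D : set A, cstar_diagonal D.
Proof.
have Tcompact n : compact [set: {i & Z n i}].
  by apply: sigT_compact => //; exact: finite_finset.
(* Rank one on the component of [y] and 0 on the others; [minimal_projection] covers both. *)
have q_min n y z : minimal_projection (q n y z).
  have [j [lj j0]] := q_line n y; case: z => i z.
  have [ij|ij] := eqVneq i j; last by rewrite -[q n y _]/(restr (q n y) i z) j0 //; exact: minimal0.
  by subst i; exact: (line_bundle_minimal z lj).
have [m [e [e_cont e_min e_orth e_sum]]] := merged_lines (p_line 0%N).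
exists (diagonal (tower_line theta lam q e mu)).
exact: (limit_cstar_diagonal Tcompact p_proj theta_iso lam_cont q_proj q_orth q_min
  phi_unital phi_inj e_cont e_min e_orth e_sum A_lim).
Qed.
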